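(* Given a random graph $G(n,m)$, there exists a single pass semi-streaming algorithm for maintaining the DFS tree incrementally, that requires $O(n\log n)$ space.
   Context: $G(n,m)$ is the random graph on $n$ vertices consisting of the first $m$ edges of a uniformly random permutation of all possible edges; the edges arrive as a stream in this order. Semi-streaming model: the input can be accessed only sequentially, in the form of a stream, and the size of the working memory is $\tilde O(n)$, i.e. $O(n)$ up to polylogarithmic factors. A single pass algorithm reads the stream once. Maintaining the DFS tree incrementally means maintaining, after every edge insertion, a DFS tree of the current graph, i.e. a rooted spanning tree produced by a depth-first search traversal. The graph is augmented with a dummy vertex $s$ (the pseudo root) joined to all vertices, and the DFS tree is rooted at $s$. *)

(* Defs.v *)
From mathcomp Require Import all_boot all_order all_algebra all_fingroup.
From mathcomp Require Import boolp.
Set Implicit Arguments.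
Unset Strict Implicit.
Unset Printing Implicit Defensive.
Import Order.TTheory GRing.Theory Num.Theory.

(** * Depth-first search *)

Section DFS.
Variables (V : finType) (adj : rel V) (r : V).

(** [dfs_reach st vis p]: a depth-first traversal started at [r], which may
    pick the next unvisited neighbour in any order, can be in the situation
    where [st] is the stack (current vertex first), [vis] is the set of visited
    vertices, and [p] gives the parent of each visited vertex other than [r]. *)
Inductive dfs_reach : seq V -> {set V} -> {ffun V -> option V} -> Prop :=
| DfsStart : dfs_reach [:: r] [set r] [ffun=> None]
| DfsPush u v st vis p :
    dfs_reach (u :: st) vis p -> adj u v -> v \notin vis ->
    dfs_reach (v :: u :: st) (v |: vis)
              [ffun x => if x == v then Some u else p x]
| DfsPop u st vis p :
    dfs_reach (u :: st) vis p -> (forall v, adj u v -> v \in vis) ->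
    dfs_reach st vis p.

Definition dfs_tree (p : {ffun V -> option V}) : Prop :=
  exists vis, dfs_reach [::] vis p.

End DFS.

(** * Graphs given as edge sequences *)

(** An unordered pair of distinct vertices, written with its smaller endpoint
    first. *)
Definition edge (n : nat) := {e : 'I_n * 'I_n | e.1 < e.2}.

Definition joins n (es : seq (edge n)) : rel 'I_n :=
  fun u v => has (fun e => (val e == (u, v)) || (val e == (v, u))) es.

(** The graph augmented with the pseudo root [None], adjacent to all vertices. *)
Definition aug_adj n (es : seq (edge n)) : rel (option 'I_n) :=
  fun x y => match x, y with
  | Some u, Some v => joins es u v
  | None, None => false
  | _, _ => true
  end.

(** * Programs on a word-addressed memory *)

Definition mem := nat -> nat.

Definition upd (m : mem) (a x : nat) : mem := [eta m with a |-> x].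

Inductive expr :=
| Const of nat
| Read of expr
| Add of expr & expr
| Sub of expr & expr
| Mul of expr & expr
| Div of expr & expr
| Mod of expr & expr
| Eq of expr & expr
| Lt of expr & expr.

Fixpoint eval (m : mem) (e : expr) : nat :=
  match e with
  | Const k => k
  | Read a => m (eval m a)
  | Add a b => eval m a + eval m b
  | Sub a b => eval m a - eval m b
  | Mul a b => eval m a * eval m b
  | Div a b => eval m a %/ eval m b
  | Mod a b => eval m a %% eval m b
  | Eq a b => eval m a == eval m b
  | Lt a b => eval m a < eval m b
  end.

Inductive cmd :=
| Skip
| Store of expr & expr
| Seq of cmd & cmd
| If of expr & cmd & cmd
| While of expr & cmd.

(** [exec S W c m m']: started in [m], the program [c] terminates in [m'], and
    during the whole execution it writes only to the addresses below [S] and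
    only words below [W].  Memory is initially zero beyond the input, so that
    reading at an address that is [S] or more carries no information.  The
    values inside an expression are not bounded separately: a fixed program has
    expressions of fixed size, so these values are polynomial in [W]. *)
Inductive exec (S W : nat) : cmd -> mem -> mem -> Prop :=
| ExecSkip m : exec S W Skip m m
| ExecStore a e m :
    eval m a < S -> eval m e < W ->
    exec S W (Store a e) m (upd m (eval m a) (eval m e))
| ExecSeq c d m1 m2 m3 :
    exec S W c m1 m2 -> exec S W d m2 m3 -> exec S W (Seq c d) m1 m3
| ExecIfTrue b c d m m' :
    eval m b != 0 -> exec S W c m m' -> exec S W (If b c d) m m'
| ExecIfFalse b c d m m' :
    eval m b = 0 -> exec S W d m m' -> exec S W (If b c d) m m'
| ExecWhileTrue b c m1 m2 m3 :
    eval m1 b != 0 -> exec S W c m1 m2 -> exec S W (While b c) m2 m3 ->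
    exec S W (While b c) m1 m3
| ExecWhileFalse b c m : eval m b = 0 -> exec S W (While b c) m m.

(** * Single-pass streaming algorithms *)

(** [on_start] is run once, before the stream; [on_edge] is run once for each
    arriving edge.  The same two programs serve for all numbers of vertices. *)
Record stream_alg := StreamAlg { on_start : cmd; on_edge : cmd }.

(** The number of vertices is given in cell 0, *)
Definition mem_start (n : nat) : mem := upd (fun=> 0) 0 n.

(** and the endpoints of the arriving edge in cells 1 and 2. *)
Definition mem_feed n (e : edge n) (m : mem) : mem :=
  upd (upd m 1 (val e).1) 2 (val e).2.

(** [alg_run S W A es m]: after the stream [es], the memory is [m], and all
    executions so far kept to [S] cells and to words below [W]. *)
Inductive alg_run (S W : nat) (A : stream_alg) (n : nat) :
    seq (edge n) -> mem -> Prop :=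
| RunStart m :
    exec S W (on_start A) (mem_start n) m -> alg_run S W A [::] m
| RunEdge es e m m' :
    alg_run S W A es m -> exec S W (on_edge A) (mem_feed e m) m' ->
    alg_run S W A (rcons es e) m'.

(** The tree is read off the memory: cell [3 + v] contains 0 if the parent of
    the vertex [v] is the pseudo root, and [u + 1] if it is the vertex [u]. *)
Definition vertex_code n (x : option 'I_n) : nat :=
  if x is Some u then u.+1 else 0.

Definition holds_tree n (m : mem)
    (p : {ffun option 'I_n -> option (option 'I_n)}) : Prop :=
  forall v : 'I_n, omap (@vertex_code n) (p (Some v)) = Some (m (3 + v)).

Definition maintains_dfs (S W : nat) (A : stream_alg) n (es : seq (edge n)) :
    Prop :=
  forall k, k <= size es ->
  exists m p, [/\ alg_run S W A (take k es) m,
                  dfs_tree (aug_adj (take k es)) None p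
                & holds_tree m p].

(** Words of [O(log n)] bits, that is, words below a fixed power of [n]; the
    shift by 2 matters only for [n < 2]. *)
Definition word_bound (c n : nat) : nat := n.+2 ^ c.

(** * The random graph G(n,m) as a random stream *)

Definition gnm_stream n (m : nat) (s : {perm edge n}) : seq (edge n) :=
  take m [seq s e | e <- enum {: edge n}].

Definition uniform_prob (T : finType) (P : T -> Prop) : rat :=
  (#|[set x : T | `[< P x >]]|%:R / #|T|%:R)%R.

(* Main.v *)
(** The algorithm freezes a growing path that starts at the pseudo root and
    belongs to all later trees.  An edge with both ends on this path is a back
    edge forever and can be forgotten; on every arrival, a depth-first search is
    run on the remembered edges, continuing from the end of the frozen path.

    Suppose that [b] vertices are not frozen and that, among the edges seen so
    far, there is one between any two disjoint sets of [b %/ 8] vertices.  As no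
    edge joins a finished vertex to an unvisited one, the search below the end
    of the frozen path can never have [b %/ 8] finished and [b %/ 8] unvisited
    vertices at the same time.  Hence its stack reaches three quarters of [b]:
    it could only stay lower if the search left that end with few vertices
    finished, but the part of the last long branch that was left unfrozen hangs
    there.  The long branch then gets frozen up to height [b %/ 2].

    In a random stream the joining property holds with high probability as soon
    as [b * k] exceeds a constant times [n ^ 2 * log n] after [k] edges, so that
    [b * k] stays bounded by this quantity.  A set of [b] vertices is then
    expected to touch [O(n log n)] of the first [k] edges, and a union bound over
    the [2 ^ n] sets shows that no set touches many more. *)

Require Import Defs.
From mathcomp Require Import all_boot all_order all_algebra all_fingroup.
From mathcomp Require Import boolp zify.
Set Implicit Arguments.
Unset Strict Implicit.
Unset Printing Implicit Defensive.

(** * Total correctness *)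

(** Since [exec] is inductive, a derivation witnesses termination together with the bounds on
    addresses and words. *)
Definition wp (S W : nat) (c : cmd) (Q : Defs.mem -> Prop) (m : Defs.mem) : Prop :=
  exists2 m', exec S W c m m' & Q m'.

Section Wp.
Variables S W : nat.
Implicit Types (Q : Defs.mem -> Prop) (m : Defs.mem).

Lemma wp_skip Q m : Q m -> wp S W Skip Q m.
Proof. by move=> Qm; exists m => //; constructor. Qed.

Lemma wp_mono c Q Q' m : (forall m', Q m' -> Q' m') -> wp S W c Q m -> wp S W c Q' m.
Proof. by move=> QQ' [m' cm /QQ']; exists m'. Qed.

Lemma wp_store a e Q m :
  eval m a < S -> eval m e < W -> Q (upd m (eval m a) (eval m e)) ->
  wp S W (Store a e) Q m.
Proof. by move=> aS eW Qm; eexists; first exact: ExecStore. Qed.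

Lemma wp_seq c d Q m : wp S W c (wp S W d Q) m -> wp S W (Seq c d) Q m.
Proof. by move=> [m1 cm1 [m2 dm2 Qm2]]; exists m2 => //; apply: ExecSeq dm2. Qed.

Lemma wp_if b c d Q m :
  (eval m b != 0 -> wp S W c Q m) -> (eval m b = 0 -> wp S W d Q m) ->
  wp S W (If b c d) Q m.
Proof.
move=> bc bd; case: (eqVneq (eval m b) 0) => [b0|b1].
  by have [m' ? ?] := bd b0; exists m' => //; apply: ExecIfFalse.
by have [m' ? ?] := bc b1; exists m' => //; apply: ExecIfTrue.
Qed.

(** The ghost value [g] carries data that the memory encodes only implicitly, such as the search
    stack; the measure is taken on it. *)
Lemma wp_while (G : Type) (I : G -> Defs.mem -> Prop) (mu : G -> nat) b c Q g m :
  I g m ->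
  (forall g m, I g m -> eval m b != 0 ->
     wp S W c (fun m' => exists2 g', I g' m' & mu g' < mu g) m) ->
  (forall g m, I g m -> eval m b = 0 -> Q m) ->
  wp S W (While b c) Q m.
Proof.
move=> Igm Ic IQ; have [k] := ubnP (mu g).
elim: k => // k IHk in g m Igm *; rewrite ltnS => gk.
case: (eqVneq (eval m b) 0) => [b0|b1].
  by exists m; [exact: ExecWhileFalse | exact: IQ Igm b0].
have [m1 cm1 [g1 Ig1 g1g]] := Ic _ _ Igm b1.
have [|m2 ? ?] := IHk g1 m1 Ig1; first exact: leq_trans g1g gk.
by exists m2 => //; apply: ExecWhileTrue cm1 _.
Qed.

End Wp.

Lemma exec_mono S S' W c m m' : S <= S' -> exec S W c m m' -> exec S' W c m m'.
Proof.
move=> SS'; elim=> {c m m'}; try by econstructor; eauto.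
by move=> a e m aS eW; constructor => //; apply: leq_trans SS'.
Qed.

Lemma updE m a x b : upd m a x b = if b == a then x else m b.
Proof. by []. Qed.

(** * Memory layout *)

(* Above the [m 0 + 3] cells of the interface, five arrays are interleaved, the
   last of which holds the scalar variables. *)
Definition loc (m : Defs.mem) (j i : nat) : nat := m 0 + (5 * i + (3 + j)).
Definition arr (m : Defs.mem) (j i : nat) : nat := m (loc m j i).
(** Indexed by vertex codes: the code [v.+1] falls on the output cell [3 + v]. *)
Definition par (m : Defs.mem) (x : nat) : nat := m (2 + x).
Definition setarr (m : Defs.mem) (j i x : nat) : Defs.mem := upd m (loc m j i) x.
Definition setpar (m : Defs.mem) (k x : nat) : Defs.mem := upd m (2 + k) x.

Lemma setarr0 m j i x : setarr m j i x 0 = m 0.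
Proof. by rewrite /setarr updE /loc; case: eqP => //; lia. Qed.

Lemma setpar0 m k x : setpar m k x 0 = m 0.
Proof. by []. Qed.

Lemma arr_setarr m j i x j' i' : j < 5 -> j' < 5 ->
  arr (setarr m j i x) j' i' = if (j' == j) && (i' == i) then x else arr m j' i'.
Proof.
move=> j5 j'5; rewrite /arr /loc setarr0 /setarr updE /loc.
case: eqP => [e|e]; last by case: andP => // -[/eqP ? /eqP ?]; case: e; lia.
by have [-> ->] : j' = j /\ i' = i; [lia | rewrite !eqxx].
Qed.

Lemma par_setarr m j i x k : k <= m 0 -> par (setarr m j i x) k = par m k.
Proof. by move=> kn; rewrite /par /setarr updE /loc; case: eqP => //; lia. Qed.

Lemma arr_setpar m k x j i : k <= m 0 -> arr (setpar m k x) j i = arr m j i.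
Proof.
by move=> kn; rewrite /arr /loc setpar0 /setpar updE; case: eqP => //; lia.
Qed.

Lemma par_setpar m k x k' :
  par (setpar m k x) k' = if k' == k then x else par m k'.
Proof. by rewrite /par /setpar updE eqn_add2l. Qed.

Definition locE (j : nat) (i : expr) : expr :=
  Add (Read (Const 0)) (Add (Mul (Const 5) i) (Const (3 + j))).
Definition Arr (j : nat) (i : expr) : expr := Read (locE j i).
Definition SetArr (j : nat) (i e : expr) : cmd := Store (locE j i) e.
Definition Par (x : expr) : expr := Read (Add (Const 2) x).
Definition SetPar (x e : expr) : cmd := Store (Add (Const 2) x) e.

Definition var (m : Defs.mem) (g : nat) : nat := arr m 4 g.
Definition setvar (m : Defs.mem) (g x : nat) : Defs.mem := setarr m 4 g x.
Definition Var (g : nat) : expr := Arr 4 (Const g).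
Definition SetVar (g : nat) (e : expr) : cmd := SetArr 4 (Const g) e.

Lemma eval_Arr m j i : eval m (Arr j i) = arr m j (eval m i).
Proof. by []. Qed.
Lemma eval_Par m x : eval m (Par x) = par m (eval m x).
Proof. by []. Qed.
Lemma eval_Var m g : eval m (Var g) = var m g.
Proof. by []. Qed.

Definition Size : expr := Read (Const 0).
Definition Incr (g : nat) : cmd := SetVar g (Add (Var g) (Const 1)).
Definition Decr (g : nat) : cmd := SetVar g (Defs.Sub (Var g) (Const 1)).
Definition Not (e : expr) : expr := Eq e (Const 0).
Definition Seqs (cs : seq cmd) : cmd := foldr Seq Skip cs.
Arguments Seqs : simpl never.

Notation Fro := (Arr 0).
Notation Vis := (Arr 1).
Notation Fst := (Arr 2).
Notation Snd := (Arr 3).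
Notation xq := 0.
Notation xcur := 1.
Notation xlen := 2.
Notation xact := 3.
Notation xcand := 4.
Notation xnew := 5.
Notation xrun := 6.
Notation xnext := 7.
Notation xi := 8.
Notation xb := 9.
Notation xcnt := 10.
Notation xj := 11.

Lemma var_setarr m j i x g : j < 4 -> var (setarr m j i x) g = var m g.
Proof. by move=> j4; rewrite /var arr_setarr; [case: ifP|..]; lia. Qed.
Lemma var_setvar m g x g' :
  var (setvar m g x) g' = if g' == g then x else var m g'.
Proof. by rewrite /var arr_setarr. Qed.
Lemma arr_setvar m g x j i : j < 4 -> arr (setvar m g x) j i = arr m j i.
Proof. by move=> j4; rewrite arr_setarr; [case: ifP|..]; lia. Qed.
Lemma setvar0 m g x : setvar m g x 0 = m 0.
Proof. exact: setarr0. Qed.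
Lemma par_setvar m g x k : k <= m 0 -> par (setvar m g x) k = par m k.
Proof. exact: par_setarr. Qed.
Lemma var_setpar m k x g : k <= m 0 -> var (setpar m k x) g = var m g.
Proof. exact: arr_setpar. Qed.

Section WpLayout.
Variables n K W : nat.
Hypotheses (K12 : 12 <= K) (nK : n < K).
Let S := n + (5 * K + 3).

(** [K] is the common length of the five arrays. The last entry of array 4 has address
    [n + 5 * K + 2], the largest one below [S]. *)
Lemma wp_setarr j ie e Q m :
  m 0 = n -> j < 5 -> eval m ie < K -> eval m e < W ->
  Q (setarr m j (eval m ie) (eval m e)) -> wp S W (SetArr j ie e) Q m.
Proof.
by move=> m0 j5 iK eW Qm; apply: wp_store => //=; rewrite m0 /S; lia.
Qed.

Lemma wp_setvar g e Q m :
  m 0 = n -> g < 12 -> eval m e < W ->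
  Q (setvar m g (eval m e)) -> wp S W (SetVar g e) Q m.
Proof.
by move=> m0 g12 eW Qm; apply: wp_setarr => //=; apply: leq_trans K12.
Qed.

Lemma wp_setpar xe e Q m :
  eval m xe <= n -> eval m e < W ->
  Q (setpar m (eval m xe) (eval m e)) -> wp S W (SetPar xe e) Q m.
Proof. by move=> xn eW Qm; apply: wp_store => //=; rewrite /S; lia. Qed.

End WpLayout.

(** * The algorithm *)

(* The vertices are represented by their codes.  Entry [i] of the arrays [Fst]
   and [Snd] holds the endpoints of a remembered edge, edges of the pseudo root
   included.  The frozen vertices, marked in [Fro], form a path from the vertex
   [xq] up to the pseudo root; [xb] is the number of other vertices.  While [xq]
   is on the stack, [xact] is set and [xlen] is the height of the stack above
   [xq].  The vertex [xcand] at height [xb / 2] becomes the new end of the frozen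
   path if the stack gets [xb / 4] higher: these further vertices stay reachable
   from it. *)

Definition start : cmd := Seqs
  [:: SetArr 0 (Const 0) (Const 1);
      SetVar xb Size;
      While (Lt (Var xcnt) Size) (Seqs
        [:: SetArr 2 (Var xcnt) (Const 0);
            SetArr 3 (Var xcnt) (Add (Var xcnt) (Const 1));
            Incr xcnt])].

Definition record_edge : cmd := Seqs
  [:: SetArr 2 (Var xcnt) (Add (Read (Const 1)) (Const 1));
      SetArr 3 (Var xcnt) (Add (Read (Const 2)) (Const 1));
      Incr xcnt].

(** Parent cells are not cleared: those of frozen vertices stay valid, and any other vertex gets a
    fresh parent when it is pushed. *)
Definition reset : cmd := Seqs
  [:: SetVar xi (Const 0);
      While (Lt (Var xi) (Add Size (Const 1))) (Seqs
        [:: SetArr 1 (Var xi) (Fro (Var xi)); Incr xi]);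
      SetVar xcur (Var xq);
      SetVar xlen (Const 0);
      SetVar xact (Const 1);
      SetVar xcand (Const 0);
      SetVar xnew (Const 0);
      SetVar xrun (Const 1)].

Definition find_next : cmd := Seqs
  [:: SetVar xnext (Const 0);
      SetVar xi (Const 0);
      While (Lt (Var xi) (Var xcnt)) (Seqs
        [:: If (Mul (Eq (Fst (Var xi)) (Var xcur)) (Not (Vis (Snd (Var xi)))))
              (SetVar xnext (Snd (Var xi))) Skip;
            If (Mul (Eq (Snd (Var xi)) (Var xcur)) (Not (Vis (Fst (Var xi)))))
              (SetVar xnext (Fst (Var xi))) Skip;
            Incr xi])].

Definition half_rest : expr := Div (Var xb) (Const 2).
Definition three_quarters : expr := Add half_rest (Div (Var xb) (Const 4)).

Definition push : cmd := Seqs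
  [:: SetPar (Var xnext) (Var xcur);
      SetArr 1 (Var xnext) (Const 1);
      SetVar xcur (Var xnext);
      If (Var xact) (Seqs
        [:: Incr xlen;
            If (Eq (Var xlen) half_rest) (SetVar xcand (Var xcur)) Skip;
            If (Eq (Var xlen) three_quarters) (SetVar xnew (Var xcand)) Skip]) Skip].

Definition pop : cmd := Seqs
  [:: If (Eq (Var xcur) (Var xq)) (SetVar xact (Const 0)) Skip;
      Decr xlen;
      If (Var xcur) (SetVar xcur (Par (Var xcur))) (SetVar xrun (Const 0))].

(** No stack is stored: a pop follows the parent cell, and each step rescans the remembered edges
    for an unvisited neighbour. *)
Definition traverse : cmd :=
  While (Var xrun) (Seq find_next (If (Var xnext) push pop)).

Definition freeze : cmd :=
  If (Var xnew) (Seqs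
    [:: SetVar xcur (Var xnew);
        While (Not (Fro (Var xcur))) (Seqs
          [:: SetArr 0 (Var xcur) (Const 1);
              Decr xb;
              SetVar xcur (Par (Var xcur))]);
        SetVar xq (Var xnew)]) Skip.

Definition compact : cmd := Seqs
  [:: SetVar xj (Const 0);
      SetVar xi (Const 0);
      While (Lt (Var xi) (Var xcnt)) (Seqs
        [:: If (Mul (Fro (Fst (Var xi))) (Fro (Snd (Var xi)))) Skip (Seqs
              [:: SetArr 2 (Var xj) (Fst (Var xi));
                  SetArr 3 (Var xj) (Snd (Var xi));
                  Incr xj]);
            Incr xi]);
      SetVar xcnt (Var xj)].

Definition step : cmd := Seqs [:: record_edge; reset; traverse; freeze; compact].

Definition stick_dfs : stream_alg := StreamAlg start step.

(** * Facts on depth-first traversals *)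

Section DfsFacts.
Variables (V : finType) (adj : rel V) (r : V).
Implicit Types (st : seq V) (vis : {set V}) (p : {ffun V -> option V}).

Definition chain p : rel V := fun x y => p x == Some y.

(** The decisive field is [dfs_closed]: no edge leads from a finished vertex to an unvisited one. *)
Record dfs_inv st vis p : Prop := DfsInv {
  dfs_uniq : uniq st;
  dfs_stack_vis : {subset st <= vis};
  dfs_last : st != [::] -> last r st = r;
  dfs_chain : sorted (chain p) st;
  dfs_root : p r = None;
  dfs_root_vis : r \in vis;
  dfs_parent : forall x y, p x = Some y -> [/\ adj y x, x \in vis & y \in vis];
  dfs_orphan : forall x, x \in vis -> x != r -> p x != None;
  dfs_closed : forall x y, x \in vis -> x \notin st -> adj x y -> y \in vis
}.

Lemma sorted_chain_eq p p' st :
  {in st, p =1 p'} -> sorted (chain p) st = sorted (chain p') st.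
Proof.
move=> pp'; apply: (@eq_in_sorted _ (mem st)) => [x y xst _|]; last exact/allP.
by rewrite /chain pp'.
Qed.

Lemma dfs_reachP st vis p : dfs_reach adj r st vis p -> dfs_inv st vis p.
Proof.
elim=> {st vis p} [|u v st vis p _ H uv vvis|u st vis p _ H uvis].
- split; rewrite ?inE ?ffunE //.
  + by move=> x; rewrite !inE.
  + by move=> x y; rewrite ffunE.
  + by move=> x; rewrite inE => ->.
  + by move=> x y; rewrite !inE => ->.
- have us : u \in vis by apply: (dfs_stack_vis H); rewrite mem_head.
  have vst : v \notin u :: st by apply: contra vvis; apply: (dfs_stack_vis H).
  split.
  + by rewrite cons_uniq vst (dfs_uniq H).
  + move=> x; rewrite inE in_setU1 => /orP[-> //|/(dfs_stack_vis H) ->].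
    by rewrite orbT.
  + by move=> _; rewrite -[RHS](dfs_last H).
  + rewrite -[sorted _ _]/(chain _ v u && sorted (chain _) (u :: st)).
    rewrite /chain ffunE eqxx eqxx andTb.
    rewrite -(@sorted_chain_eq p) ?(dfs_chain H) // => x xst; rewrite ffunE.
    by case: eqP xst => // -> /(negP vst).
  + rewrite ffunE; case: eqP => [rv|_]; last exact: dfs_root H.
    by move: vvis; rewrite -rv (dfs_root_vis H).
  + by rewrite in_setU1 (dfs_root_vis H) orbT.
  + move=> x y; rewrite ffunE !in_setU1; case: eqP => [-> [<-]|_].
      by rewrite us orbT.
    by case/(dfs_parent H) => -> -> ->; rewrite !orbT.
  + move=> x; rewrite in_setU1 ffunE; case: eqP => //= _.
    exact: (dfs_orphan H).
  + move=> x y; rewrite !in_setU1 inE => /orP[/eqP ->|xv].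
      by rewrite eqxx.
    by case: eqP => //= _ xst /(dfs_closed H xv xst) ->; rewrite orbT.
- have := H; case=> /= /andP[ust ust'] sub la ch pr rv pa orp cl; split=> //.
  + by move=> x xst; apply: sub; rewrite inE xst orbT.
  + by move: la; clear; case: st => // z st la _; exact: (la isT).
  + exact: path_sorted ch.
  + move=> x y xv xst; have [->|xu] := eqVneq x u; first exact: uvis.
    by apply: cl => //; rewrite inE negb_or xu.
Qed.

Definition restrict st p : {ffun V -> option V} :=
  [ffun x => if x \in st then p x else None].

Lemma dfs_restart st p :
  uniq st -> st != [::] -> last r st = r -> sorted (chain p) st -> p r = None ->
  (forall x y, p x = Some y -> adj y x) ->
  dfs_reach adj r st [set x in st] (restrict st p).
Proof.
move=> ust st0 la ch pr pa; elim: st ust st0 la ch => // x [|y st] IH.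
  move=> _ _ /= -> _.
  have -> : [set z in [:: r]] = [set r] by apply/setP => z; rewrite !inE.
  have -> : restrict [:: r] p = [ffun=> None].
    by apply/ffunP => z; rewrite !ffunE inE; case: eqP => // ->.
  exact: DfsStart.
case/andP=> xst ust _ la /andP[/eqP pxy ch].
have {}IH := IH ust isT la ch.
have -> : [set z in x :: y :: st] = x |: [set z in y :: st].
  by apply/setP => z; rewrite !inE.
have -> : restrict (x :: y :: st) p =
    [ffun z => if z == x then Some y else restrict (y :: st) p z].
  apply/ffunP => z; rewrite !ffunE in_cons.
  by case: eqP => [->|].
by apply: DfsPush => //; [exact: pa | rewrite inE].
Qed.

(** Along [s], each vertex is visited and off the stack, hence finished, so [dfs_closed] passes
    visitedness on to the next one. *)
Lemma dfs_component q fz vis p s :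
  dfs_inv (q :: fz) vis p -> (forall v, adj q v -> v \in vis) ->
  path adj q s -> {in s, forall x, x \notin q :: fz} -> {subset s <= vis}.
Proof.
move=> H; suff gen: forall q', (forall v, adj q' v -> v \in vis) ->
    path adj q' s -> {in s, forall x, x \notin q :: fz} -> {subset s <= vis}.
  exact: gen.
elim: s => //= x s IH q' q'v /andP[/q'v xv ps] sq y.
rewrite inE => /orP[/eqP -> //|ys]; apply: (IH x) ys => //.
- by move=> z; apply: (dfs_closed H) => //; apply: sq; rewrite mem_head.
- by move=> z zs; apply: sq; rewrite inE zs orbT.
Qed.

Lemma dfs_spanning vis p :
  dfs_inv [::] vis p -> (forall x, x != r -> adj r x) -> forall x, x \in vis.
Proof.
move=> H rx x; have [->|xr] := eqVneq x r; first exact: dfs_root_vis H.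
exact: (dfs_closed H) (dfs_root_vis H) _ (rx _ xr).
Qed.

End DfsFacts.

(** * Freezing a long branch *)

Section Search.
Variables (V : finType) (r : V) (adj : rel V) (fz : seq V).
Implicit Types (p : {ffun V -> option V}) (st stk : seq V) (vis : {set V}).

Let k := size fz.
Let b := #|V| - k.
Let q := head r fz.
Definition freeze_len : nat := b %/ 2.
Definition branch_len : nat := b %/ 2 + b %/ 4.
Notation h := freeze_len.
Notation T := branch_len.

Record stick : Prop := Stick {
  stick_uniq : uniq fz;
  stick_nil : fz != [::];
  stick_last : last r fz = r
}.

Definition reachable_outside : Prop :=
  exists2 R : {set V}, b %/ 8 <= #|R| &
    forall x, x \in R -> exists s,
      [/\ path adj q s, last q s = x, x \notin fz & {in s, forall y, y \notin fz}].

Definition well_joined (a : nat) : Prop :=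
  forall F U : {set V}, #|F| = a -> #|U| = a -> [disjoint F & U] ->
    r \notin F -> r \notin U -> exists x y, [/\ x \in F, y \in U & adj x y].

Definition must_freeze : Prop := [/\ 8 <= b, reachable_outside & well_joined (b %/ 8)].

Definition cand st : V := nth r (rev st) (k + h).-1.

(** A snapshot of the stack when it reached height [T], phrased through [p] and [vis] because these
    vertices may be popped later. *)
Record branch p vis nw : Prop := Branch {
  branch_h : 0 < h;
  branch_pre : seq V;
  branch_uniq : uniq (branch_pre ++ fz);
  branch_chain : sorted (chain p) (branch_pre ++ fz);
  branch_vis : {subset branch_pre <= vis};
  branch_size : size branch_pre = T;
  branch_new : nw = cand (branch_pre ++ fz)
}.

(** The value [nw = r] means that no new end has been found, the root being frozen from the start.
    As the stack is part of [vis], [search_must] bounds the number of finished vertices. *)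
Record search (act : bool) nw stk vis p : Prop := Search {
  search_reach : dfs_reach adj r stk vis p;
  search_fz : {subset fz <= vis};
  search_chain : sorted (chain p) fz;
  search_act : act -> exists2 pre, stk = pre ++ fz & nw = r -> 0 < T -> size pre < T;
  search_new : nw != r -> branch p vis nw;
  search_must : must_freeze -> nw = r -> act /\ #|vis| < b %/ 8 + size stk
}.

Hypothesis S : stick.

Lemma r_fz : r \in fz.
Proof.
case: S => _ + <-; case: fz => //= x s _; exact: mem_last.
Qed.

Lemma q_fz : q \in fz.
Proof. by rewrite /q; case: S => _; case: fz => // x s; rewrite mem_head. Qed.

Lemma k_gt0 : 0 < k.
Proof. by case: S => _; rewrite /k lt0n size_eq0. Qed.

Lemma cand_notin pre : 0 < h <= size pre -> uniq (pre ++ fz) -> cand (pre ++ fz) \notin fz.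
Proof.
move=> /andP[h0 hp]; rewrite cat_uniq => /and3P[_ /hasPn pf _].
rewrite /cand rev_cat nth_cat size_rev -/k; have k0 := k_gt0.
rewrite ifN; last by lia.
have xpre : nth r (rev pre) ((k + h).-1 - k) \in pre.
  have lt : (k + h).-1 - k < size pre by lia.
  by rewrite -mem_rev mem_nth // size_rev.
by apply/negP => /pf; rewrite xpre.
Qed.

Lemma branch_ext p p' vis vis' nw :
  {subset fz <= vis} -> {in vis, p =1 p'} -> {subset vis <= vis'} ->
  branch p vis nw -> branch p' vis' nw.
Proof.
move=> fv pp' vv' [h0 pre upre cpre pv sp cn]; exists pre => //.
- rewrite -(@sorted_chain_eq _ p) // => x; rewrite mem_cat => /orP[/pv|/fv]; exact: pp'.
- by move=> x /pv /vv'.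
Qed.

Lemma search_init p :
  sorted (chain p) fz -> p r = None -> (forall x y, p x = Some y -> adj y x) ->
  search true r fz [set x in fz] (restrict fz p).
Proof.
move=> cp pr pa; split.
- by apply: dfs_restart => //; case: S.
- by move=> x; rewrite inE.
- by rewrite -(@sorted_chain_eq _ p) // => x xf; rewrite ffunE xf.
- by move=> _; exists [::].
- by rewrite eqxx.
- move=> [b8 _ _] _; split=> //.
  have b0 : 0 < b %/ 8 by lia.
  by rewrite cardsE -[_.+1]add1n; apply: leq_add b0 (card_size fz).
Qed.

(** A push finishes no vertex, so both sides of the bound in [search_must] grow by one. If the
    height becomes [T], the stack itself is the required branch. *)
Lemma search_push act nw u y st vis p :
  search act nw (u :: st) vis p -> adj u y -> y \notin vis ->
  let stk := [:: y, u & st] in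
  search act (if act && (size stk == k + T) then cand stk else nw) stk
    (y |: vis) [ffun x => if x == y then Some u else p x].
Proof.
move=> H uy yv; set p' := finfun _; move=> stk.
have R' : dfs_reach adj r stk (y |: vis) p' by apply: DfsPush (search_reach H) uy yv.
have I' := dfs_reachP R'.
have fv := search_fz H.
have pp' : {in vis, p =1 p'}.
  by move=> x xv; rewrite ffunE; case: eqP xv yv => // -> ->.
have vv' : {subset vis <= y |: vis} by move=> x xv; rewrite in_setU1 xv orbT.
have fired : act && (size stk == k + T) ->
    branch p' (y |: vis) (cand stk) /\ cand stk != r.
  move=> /andP[actT /eqP sT]; have [pre e _] := search_act H actT.
  have es : stk = (y :: pre) ++ fz by rewrite /stk e.
  have {sT} sT : size (y :: pre) = T by move: sT; rewrite es size_cat -/k; lia.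
  have h0 : 0 < h by move: sT; rewrite /h /T /=; lia.
  split.
    exists (y :: pre); rewrite -?es //; first exact: dfs_uniq I'.
      exact: dfs_chain I'.
    by move=> x xp; apply: (dfs_stack_vis I'); rewrite es mem_cat xp.
  have : cand stk \notin fz.
    rewrite es; apply: cand_notin; last by rewrite -es (dfs_uniq I').
    by rewrite h0 sT /T leq_addr.
  by apply: contraNneq => ->; exact: r_fz.
split=> //.
- by move=> x /fv /vv'.
- by rewrite -(@sorted_chain_eq _ p) ?(search_chain H) // => x /fv; apply: pp'.
- move=> actT; have [pre e lt] := search_act H actT.
  exists (y :: pre); first by rewrite /stk e.
  case: ifP fired => [_ /(_ isT)[_ /eqP //]|+ _].
  rewrite actT /stk e /= size_cat -/k => /negbT sT /lt{}lt /lt{}lt.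
  by rewrite ltn_neqAle lt andbT; apply: contra sT => /eqP <-; lia.
- case: ifP fired => [_ /(_ isT)[] //|_ _ /(search_new H)].
  exact: branch_ext.
- move=> must; case: ifP fired => [_ /(_ isT)[_ /eqP //]|_ _ nw0].
  have [-> lt] := search_must H must nw0; split=> //.
  by rewrite cardsU1 yv; move: lt; rewrite /=; lia.
Qed.

(* If no branch gets long, then at most [b %/ 8] vertices below [q] are ever
   finished, for otherwise that many of them and that many unvisited vertices
   would not be joined; but all vertices that can be reached from [q] get
   finished before [q] is. *)
Lemma search_pop act nw u st vis p :
  search act nw (u :: st) vis p -> (forall v, adj u v -> v \in vis) ->
  search (act && (u != q)) nw st vis p.
Proof.
move=> H uv; have R' := DfsPop (search_reach H) uv.
have I := dfs_reachP (search_reach H); have I' := dfs_reachP R'.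
have uI := dfs_uniq I.
split=> //; [exact: search_fz H | exact: search_chain H | | exact: search_new H |].
  case/andP=> actT uq; have [pre e lt] := search_act H actT.
  case: pre e lt => [|x pre] /= e lt; first by rewrite /q -e eqxx in uq.
  by case: e => _ ->; exists pre => // nw0 T0; have := lt nw0 T0; lia.
move=> must nw0; have [actT lt] := search_must H must nw0.
have [b8 [R aR RP] joined] := must.
have [pre e lt'] := search_act H actT.
case: pre e lt' => [|x pre] /= e lt'.
  suff Rsub : R \subset vis :\: [set x in fz].
    have := leq_trans aR (subset_leq_card Rsub).
    have fv : [set x in fz] \subset vis by apply/subsetP => x; rewrite inE => /(search_fz H).
    have szf : #|[set x in fz]| = size fz.
      by rewrite cardsE; apply/card_uniqP; apply: stick_uniq.
    have {}lt : #|vis| < b %/ 8 + size fz by rewrite -e.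
    by rewrite cardsD (setIidPr fv) szf; lia.
  apply/subsetP => x /RP[s [ps ls xf sf]]; rewrite !inE xf /=.
  have eq : q = u by rewrite /q -e.
  have := dfs_component I uv (s := s); rewrite -eq => /(_ ps).
  rewrite eq e => /(_ sf) sv.
  move: xf; rewrite -ls; case: (lastP s) sv => [|s' z] sv /=.
    by rewrite q_fz.
  by rewrite last_rcons => _; apply: sv; rewrite mem_rcons mem_head.
case: e => ? est; subst x.
have ust : uniq (u :: pre ++ fz) by rewrite -est.
have upre : u \notin fz by move: ust; rewrite /= mem_cat negb_or => /andP[/andP[]].
have uq : u != q by apply: contraNneq upre => ->; exact: q_fz.
rewrite actT uq; split=> //.
have {}lt' : size (u :: pre) < T by apply: lt' => //; rewrite /T; lia.
rewrite ltn_neqAle; apply/andP; split; last by move: lt => /=; lia.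
(* A pop finishes one vertex, so the bound can only fail with exactly [b %/ 8] finished vertices. *)
apply/negP => /eqP visE.
have sv : [set x in st] \subset vis.
  by apply/subsetP => x; rewrite inE; apply: dfs_stack_vis I' x.
have szst : #|[set x in st]| = size st.
  by rewrite cardsE; apply/card_uniqP; case/andP: uI.
pose F := vis :\: [set x in st].
have cF : #|F| = b %/ 8 by rewrite cardsD (setIidPr sv) szst; lia.
(* Of the [b] unfrozen vertices, [b %/ 8] are finished and fewer than [b %/ 2 + b %/ 4] are on the
   stack. *)
have cU : b %/ 8 <= #|~: vis|.
  have := cardsC vis; rewrite visE est size_cat -/k.
  by move: lt'; rewrite /T /b /= ; lia.
have [U UU cUa] : exists2 U : {set V}, U \subset ~: vis & #|U| = b %/ 8.
  have sz : b %/ 8 <= size (enum (~: vis)) by rewrite -cardE.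
  exists [set x in take (b %/ 8) (enum (~: vis))].
    by apply/subsetP => x; rewrite inE => /mem_take; rewrite mem_enum.
  rewrite cardsE; have /card_uniqP -> := take_uniq (b %/ 8) (enum_uniq (~: vis)).
  by rewrite size_takel.
have rst : r \in st by rewrite est mem_cat r_fz orbT.
have [| | |x [y [xF yU xy]]] := joined F U cF cUa.
- rewrite -setI_eq0; apply/eqP/setP => x; rewrite !inE.
  apply/negP => /andP[/andP[_ xv] /(subsetP UU)].
  by rewrite inE xv.
- by rewrite !inE rst.
- by apply/negP => /(subsetP UU); rewrite inE (dfs_root_vis I).
move: xF; rewrite !inE => /andP[xst xv].
have := dfs_closed I' xv xst xy.
by apply/negP; move/(subsetP UU): yU; rewrite inE.
Qed.

(** Otherwise [act] would still hold, and the stack would still contain the nonempty frozen path. *)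
Lemma search_end act nw vis p :
  search act nw [::] vis p -> must_freeze -> nw != r.
Proof.
move=> H must; apply/eqP => nw0; have [actT _] := search_must H must nw0.
by have [pre + _] := search_act H actT; case: S => _; case: pre; case: fz.
Qed.

End Search.

(** * Rewriting rules and tactics for symbolic execution *)

Section EvalSeqs.
Variables (m : Defs.mem) (S W : nat) (Q : Defs.mem -> Prop).

Lemma eval_Const k : eval m (Const k) = k. Proof. by []. Qed.
Lemma eval_cell k : eval m (Read (Const k)) = m k. Proof. by []. Qed.
Lemma eval_Add a b : eval m (Add a b) = eval m a + eval m b. Proof. by []. Qed.
Lemma eval_Sub a b : eval m (Defs.Sub a b) = eval m a - eval m b. Proof. by []. Qed.
Lemma eval_Mul a b : eval m (Mul a b) = eval m a * eval m b. Proof. by []. Qed.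
Lemma eval_Div a b : eval m (Div a b) = eval m a %/ eval m b. Proof. by []. Qed.
Lemma eval_Eq a b : eval m (Eq a b) = (eval m a == eval m b). Proof. by []. Qed.
Lemma eval_Lt a b : eval m (Lt a b) = (eval m a < eval m b). Proof. by []. Qed.
Lemma eval_Not a : eval m (Not a) = (eval m a == 0). Proof. by []. Qed.

Lemma wp_seqs c cs : wp S W c (wp S W (Seqs cs) Q) m -> wp S W (Seqs (c :: cs)) Q m.
Proof. exact: wp_seq. Qed.
Lemma wp_seqs0 : Q m -> wp S W (Seqs [::]) Q m.
Proof. exact: wp_skip. Qed.
End EvalSeqs.

Definition evE := (eval_Var, eval_Arr, eval_Par, eval_Const, eval_cell, eval_Add,
  eval_Sub, eval_Mul, eval_Div, eval_Eq, eval_Lt, eval_Not).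

Lemma setarr_low m j i x k : k < 3 -> setarr m j i x k = m k.
Proof. by move=> k3; rewrite /setarr updE /loc; case: eqP => //; lia. Qed.

Lemma setvar_low m g x k : k < 3 -> setvar m g x k = m k.
Proof. exact: setarr_low. Qed.

Definition cellE := (setvar0, setarr0, setpar0, setarr_low, setvar_low).
Definition getE := (var_setvar, arr_setvar, var_setarr, arr_setarr, par_setpar).

Ltac wp_set :=
  apply: wp_seqs;
  first [apply: wp_setvar | apply: wp_setarr | apply: wp_setpar];
  rewrite ?evE ?cellE ?getE //; try lia.

Ltac simp_mem :=
  move=> *; rewrite ?(par_setvar, par_setarr) ?cellE ?getE; try (congruence || lia).

(** * Recording an edge, resetting the marks, and scanning for an unvisited neighbour *)

Section Primitives.
Variables n K W : nat.
Hypotheses (K12 : 12 <= K) (nK : n < K) (KW : K < W).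
Let S := n + (5 * K + 3).
Notation V := (option 'I_n).
Notation code := (@vertex_code n).
Notation d0 := (None, None).
Implicit Types (m : Defs.mem) (E : seq (V * V)) (p : {ffun V -> option V}).
Implicit Types (q : V) (fz st : seq V) (vis : {set V}).

Lemma code_inj : injective code.
Proof. by move=> [x|] [y|] //= [] /ord_inj ->. Qed.

Lemma code_le x : code x <= n.
Proof. by case: x => [x|] //=. Qed.

Lemma code_onto i : i <= n -> exists x, i = code x.
Proof. by case: i => [|i] ni; [exists None | exists (Some (Ordinal ni))]. Qed.

Lemma code_eq x y : (code x == code y) = (x == y).
Proof. exact: inj_eq code_inj x y. Qed.

Lemma code_eq0 x : (code x == 0) = (x == None).
Proof. exact: (code_eq x None). Qed.

Definition entries m E : Prop :=
  var m xcnt = size E /\ forall i, i < size E ->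
    arr m 2 i = code (nth d0 E i).1 /\ arr m 3 i = code (nth d0 E i).2.

Definition marks m j (A : {pred V}) : Prop := forall x, arr m j (code x) = (x \in A).

Definition parents m p : Prop :=
  p None = None /\ forall x y, p x = Some y -> par m (code x) = code y.

Lemma arr_feed m (e : edge n) j i : arr (mem_feed e m) j i = arr m j i.
Proof.
by rewrite /arr /loc /mem_feed !updE /=; do 2!(case: eqP => [|_]; first lia).
Qed.

Record state q fz E p m : Prop := State {
  state_size : m 0 = n;
  state_fro : marks m 0 (mem fz);
  state_q : var m xq = code q;
  state_b : var m xb = n.+1 - size fz;
  state_entries : entries m E;
  state_parents : parents m p
}.

Lemma state_eq q fz E p m m' :
  m' 0 = m 0 -> (forall x, arr m' 0 (code x) = arr m 0 (code x)) -> var m' xq = var m xq ->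
  var m' xb = var m xb -> var m' xcnt = var m xcnt ->
  (forall i, arr m' 2 i = arr m 2 i) -> (forall i, arr m' 3 i = arr m 3 i) ->
  (forall k, k <= n -> par m' k = par m k) ->
  state q fz E p m -> state q fz E p m'.
Proof.
move=> e0 e1 e2 e3 e4 e5 e6 e7 [s0 s1 s2 s3 [s4 s5] [s6 s7]].
split; rewrite ?e0 ?e2 ?e3 //.
- by move=> x; rewrite e1.
- by split; [rewrite e4 | move=> i /s5; rewrite e5 e6].
- by split=> // x y /s7 <-; rewrite e7 // code_le.
Qed.

Lemma wp_record_edge q fz E p m (e : edge n) Q :
  state q fz E p m -> size E < K ->
  (forall m', state q fz (rcons E (Some (val e).1, Some (val e).2)) p m' -> Q m') ->
  wp S W record_edge Q (mem_feed e m).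
Proof.
move=> [s0 s1 s2 s3 [s4 s5] [s6 s7]] EK HQ.
(* Feeding an edge overwrites cell 2, which is also the parent cell of code 0; [parents] claims
   nothing about it, since the root has no parent. *)
have {s7} : forall x y, p x = Some y -> par (mem_feed e m) (code x) = code y.
  by move=> [x|] y; [move/s7 | rewrite s6].
have {s4 s5} : entries (mem_feed e m) E.
  by split=> [|i]; rewrite ?/var !arr_feed //; exact: s5.
have {s3} : var (mem_feed e m) xb = n.+1 - size fz by rewrite /var arr_feed.
have {s2} : var (mem_feed e m) xq = code q by rewrite /var arr_feed.
have {s1} : marks (mem_feed e m) 0 (mem fz) by move=> x; rewrite arr_feed.
have {s0} : mem_feed e m 0 = n by [].
have : mem_feed e m 1 = (val e).1 by [].
have : mem_feed e m 2 = (val e).2 by [].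
move: (mem_feed e m) => {}m m2 m1 m0 s1 s2 s3 [s4 s5] s7.
wp_set; rewrite ?s4 //.
  by rewrite m1; have := ltn_ord (val e).1; lia.
wp_set; rewrite ?s4 //.
  by rewrite m2; have := ltn_ord (val e).2; lia.
wp_set; rewrite ?s4 //; try lia.
apply: wp_seqs0; apply: HQ; rewrite m1 m2.
split; rewrite ?cellE ?getE //.
- by move=> x; rewrite !getE //=; exact: s1.
- split; first by rewrite ?getE // size_rcons addn1.
  move=> i; rewrite size_rcons nth_rcons ltnS leq_eqVlt ?getE //= => /predU1P[->|iE].
    by rewrite ltnn eqxx /= !addn1.
  by rewrite (ltn_eqF iE) iE; apply: s5.
- split=> // x y pxy.
  by rewrite !par_setarr ?cellE ?m0 ?code_le //; apply: s7.
Qed.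

Lemma wp_reset q fz E p m Q :
  state q fz E p m ->
  (forall m', state q fz E p m' -> marks m' 1 (mem fz) ->
     var m' xcur = code q -> var m' xlen = 0 -> var m' xact = 1 ->
     var m' xcand = 0 -> var m' xnew = 0 -> var m' xrun = 1 -> Q m') ->
  wp S W reset Q m.
Proof.
move=> sm HQ; have m0 := state_size sm.
wp_set.
apply: wp_seqs; apply: (wp_while (G := nat) (g := 0) (mu := fun i => n.+1 - i)
  (I := fun i m => [/\ state q fz E p m, var m xi = i, i <= n.+1 &
     forall x, code x < i -> arr m 1 (code x) = (x \in fz)])).
- split=> //; last by rewrite getE.
  by apply: state_eq sm; simp_mem.
- move=> i {m0 HQ} {}m [{}sm mi iN mx]; have m0 := state_size sm.
  rewrite !evE mi m0 addn1 ltnS; case: leqP => // iN' _.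
  have [x ix] := code_onto iN'.
  have fx := state_fro sm x; rewrite -ix in fx.
  wp_set; rewrite ?mi //; try lia.
  rewrite fx; wp_set; rewrite ?mi //; try lia.
  apply: wp_seqs0; exists i.+1; last by lia.
  split; rewrite ?getE ?addn1 //.
  + by apply: state_eq sm; simp_mem.
  + move=> y; rewrite !getE //= ltnS leq_eqVlt ix code_eq.
    by case: eqVneq => [-> //|_ /=]; rewrite -ix; apply: mx.
move=> i {m0} {}m [{}sm mi iN mx]; have m0 := state_size sm.
rewrite !evE mi m0 addn1 ltnS; case: leqP => // iN' _.
have {iN' iN} iN : i = n.+1 by lia.
wp_set; first by rewrite (state_q sm); have := code_le q; lia.
do 5!wp_set.
apply: wp_seqs0; apply: HQ; rewrite ?getE //; last exact: state_q sm.
- by apply: state_eq sm; simp_mem.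
- by move=> x; rewrite !getE //= mx // iN ltnS code_le.
Qed.

Definition same (vs : seq nat) m m' : Prop :=
  [/\ m' 0 = m 0, forall j i, j < 4 -> arr m' j i = arr m j i,
      forall k, k <= n -> par m' k = par m k &
      forall g, g \notin vs -> var m' g = var m g].

Lemma same_setvar vs m m' g x :
  m 0 = n -> g \in vs -> same vs m m' -> same vs m (setvar m' g x).
Proof.
move=> m0 gvs [e0 e1 e2 e3]; split=> [|j i j4|k kn|h hvs].
- by rewrite setvar0.
- by rewrite arr_setvar // e1.
- by rewrite par_setvar ?e0 ?m0 // e2.
- by rewrite var_setvar; case: eqP => [hg|_]; [rewrite hg gvs in hvs | exact: e3].
Qed.

Lemma same_state vs q fz E p m m' :
  all (fun g => g \notin [:: xq; xb; xcnt]) vs -> same vs m m' ->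
  state q fz E p m -> state q fz E p m'.
Proof.
move=> /allP vsP [e0 e1 e2 e3]; have vsN g : g \in [:: xq; xb; xcnt] -> g \notin vs.
  by move=> gq; apply/negP => /vsP; rewrite gq.
by apply: state_eq => // *; rewrite ?e1 ?e3 // vsN.
Qed.

Definition arcs E : seq (V * V) := flatten [seq [:: e; (e.2, e.1)] | e <- E].

(* [None] stands for failure, the pseudo root never being searched for. *)
Definition found (u : V) vis (l : seq (V * V)) (y : V) : Prop :=
  if y is None then forall z, (u, z) \in l -> z \in vis
  else y \notin vis /\ (u, y) \in l.

(** Serves both tests in the body of [find_next], with the two endpoint arrays exchanged. A later
    hit overwrites an earlier one, which is harmless as any unvisited neighbour will do. *)
Lemma wp_probe m0 m l vis u x y z j j' i Q :
  m0 0 = n -> same [:: xnext; xi] m0 m -> marks m 1 (mem vis) -> None \in vis ->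
  var m xcur = code u -> var m xi = i -> j < 4 -> j' < 4 ->
  arr m j i = code x -> arr m j' i = code z ->
  var m xnext = code y -> found u vis l y ->
  (forall y' m', same [:: xnext; xi] m0 m' -> var m' xi = i ->
     var m' xnext = code y' -> found u vis (rcons l (x, z)) y' -> Q m') ->
  wp S W (If (Mul (Eq (Arr j (Var xi)) (Var xcur)) (Not (Vis (Arr j' (Var xi)))))
             (SetVar xnext (Arr j' (Var xi))) Skip) Q m.
Proof.
move=> m00 sm mvis rv mu mi j4 j'4 mx mz my yP HQ.
have m0n : m 0 = n by case: sm => ->.
apply: wp_if; rewrite !evE mu mi mx mz mvis code_eq eqb0.
- rewrite muln_eq0 negb_or !eqb0 !negbK => /andP[/eqP xu zvis].
  apply: wp_setvar; rewrite ?evE ?mi //.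
    by rewrite mz; have := code_le z; lia.
  apply: (HQ z); rewrite ?getE //; first exact: same_setvar.
  case: z zvis {mz HQ} => [z|]; last by rewrite /= rv.
  by rewrite /found xu mem_rcons mem_head.
- move=> /eqP; rewrite muln_eq0 !eqb0 negbK => xz.
  apply: wp_skip; apply: (HQ y) => //; case: y yP {my HQ} => [y|] /= yP.
    by split; [case: yP | rewrite mem_rcons inE; case: yP => _ ->; rewrite orbT].
  move=> w; rewrite mem_rcons inE => /predU1P[[ux ->]|/yP //].
  by move: xz; rewrite ux eqxx.
Qed.

Lemma wp_find_next q fz E p vis u m Q :
  state q fz E p m -> size E <= K -> marks m 1 (mem vis) -> None \in vis ->
  var m xcur = code u ->
  (forall y m', same [:: xnext; xi] m m' -> var m' xnext = code y ->
     found u vis (arcs E) y -> Q m') ->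
  wp S W find_next Q m.
Proof.
move=> sm EK mvis rv mu HQ; have m0 := state_size sm.
have sS m' (sm' : same [:: xnext; xi] m m') := @same_state [:: xnext; xi] _ _ _ _ _ m' isT sm' sm.
wp_set. wp_set.
apply: wp_seqs; apply: (wp_while (G := nat) (g := 0) (mu := fun i => size E - i)
  (I := fun i m' => [/\ same [:: xnext; xi] m m', var m' xi = i, i <= size E &
     exists2 y, var m' xnext = code y & found u vis (arcs (take i E)) y])).
- split=> //; rewrite ?getE //; first by apply: same_setvar => //; apply: same_setvar.
  by exists None; rewrite ?getE // take0.
- move=> i m' [sm' mi iE [y my yP]].
  have sm'' := sS _ sm'; have [sc sE] := state_entries sm''.
  rewrite !evE mi sc; case: ltnP => // iE' _; have [m2 m3] := sE _ iE'.
  have mu' g : g \notin [:: xnext; xi] -> var m' g = var m g by case: sm' => _ _ _; apply.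
  have mv : marks m' 1 (mem vis) by move=> x; case: sm' => _ -> //.
  apply: wp_seqs; apply: (wp_probe m0 sm' mv rv _ mi _ _ m2 m3 my yP) => //.
    by rewrite mu'.
  move=> {my yP} y {mu' sm'' sc sE mi m2 m3 mv sm'}m' sm' mi my yP.
  have sm'' := sS _ sm'; have [sc sE] := state_entries sm''.
  have [m2 m3] := sE _ iE'.
  have mu' g : g \notin [:: xnext; xi] -> var m' g = var m g by case: sm' => _ _ _; apply.
  have mv : marks m' 1 (mem vis) by move=> x; case: sm' => _ -> //.
  apply: wp_seqs; apply: (wp_probe m0 sm' mv rv _ mi _ _ m3 m2 my yP) => //.
    by rewrite mu'.
  move=> {my yP} y {mu' sm'' sc sE mi m2 m3 mv sm'}m' sm' mi my yP.
  have m'0 : m' 0 = n by case: sm' => ->.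
  wp_set; rewrite mi.
  apply: wp_seqs0; exists i.+1; last by lia.
  split; rewrite ?getE ?addn1 //; first exact: same_setvar.
  exists y; rewrite ?getE // (take_nth d0) // /arcs map_rcons flatten_rcons.
  by move: yP; rewrite -cats1 -cats1 -catA; case: (nth _ _ _).
move=> i m' [sm' mi iE [y my yP]].
have [sc _] := state_entries (sS _ sm').
rewrite !evE mi sc; case: ltnP => // iE' _; apply: wp_seqs0; apply: HQ my _ => //.
by rewrite take_oversize in yP.
Qed.
End Primitives.

(** * Correctness of the traversal loop *)

Section Search_loop.
Variables n K W : nat.
Hypotheses (K12 : 12 <= K) (nK : n < K) (KW : K < W).
Let S := n + (5 * K + 3).
Notation V := (option 'I_n).
Notation code := (@vertex_code n).
Notation d0 := (None, None).
Implicit Types (m : Defs.mem) (E : seq (V * V)) (p : {ffun V -> option V}).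
Implicit Types (q : V) (fz st : seq V) (vis : {set V}).

Lemma card_vertices : #|{: V}| = n.+1.
Proof. by rewrite card_option card_ord. Qed.

Lemma uniq_size st : uniq st -> size st <= n.+1.
Proof. by move/card_uniqP <-; rewrite -card_vertices max_card. Qed.

(** The second test reads the candidate as just updated by the first; this matters when [b %/ 4 = 0]
    and the two heights coincide. *)
Lemma wp_mark m Q :
  m 0 = n -> var m xlen < n -> var m xcur <= n -> var m xcand <= n ->
  (forall m', same n [:: xlen; xcand; xnew] m m' -> var m' xlen = (var m xlen).+1 ->
     var m' xcand =
       (if (var m xlen).+1 == var m xb %/ 2 then var m xcur else var m xcand) ->
     var m' xnew = (if (var m xlen).+1 == var m xb %/ 2 + var m xb %/ 4
                    then var m' xcand else var m xnew) -> Q m') ->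
  wp S W (Seqs
    [:: Incr xlen;
        If (Eq (Var xlen) half_rest) (SetVar xcand (Var xcur)) Skip;
        If (Eq (Var xlen) three_quarters) (SetVar xnew (Var xcand)) Skip]) Q m.
Proof.
move=> m0 len cur ca HQ.
have sS m1 g x : g \in [:: xlen; xcand; xnew] -> same n [:: xlen; xcand; xnew] m m1 ->
    same n [:: xlen; xcand; xnew] m (setvar m1 g x) by exact: same_setvar.
wp_set.
apply: wp_seqs; apply: wp_if; rewrite !evE !getE /= addn1.
- rewrite eqb0 negbK => c1.
  apply: (wp_setvar K12 nK); rewrite ?cellE ?evE ?getE //=; first by lia.
  apply: wp_seqs; apply: wp_if; rewrite !evE !getE /=.
  + rewrite eqb0 negbK => c2.
    apply: (wp_setvar K12 nK); rewrite ?cellE ?evE ?getE //=; first by lia.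
    apply: wp_seqs0; apply: HQ; rewrite ?getE /= ?c1 ?c2 //.
    by do 2!apply: (sS) => //; apply: sS.
  + move/eqP; rewrite eqb0 => /negbTE c2.
    apply: wp_skip; apply: wp_seqs0; apply: HQ; rewrite ?getE /= ?c1 ?c2 //.
    by apply: (sS) => //; apply: sS.
- move/eqP; rewrite eqb0 => /negbTE c1.
  apply: wp_skip; apply: wp_seqs; apply: wp_if; rewrite !evE !getE /=.
  + rewrite eqb0 negbK => c2.
    apply: (wp_setvar K12 nK); rewrite ?cellE ?evE ?getE //=; first by lia.
    apply: wp_seqs0; apply: HQ; rewrite ?getE /= ?c1 ?c2 //.
    by apply: (sS) => //; apply: sS.
  + move/eqP; rewrite eqb0 => /negbTE c2.
    apply: wp_skip; apply: wp_seqs0; apply: HQ; rewrite ?getE /= ?c1 ?c2 //.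
    exact: sS.
Qed.

Section Dfs.
Variables (adj : rel V) (fz : seq V) (E : seq (V * V)).
Notation q := (head None fz).
Hypothesis arcs_adj : forall x y, (x, y) \in arcs E -> adj x y.
Hypothesis adj_arcs :
  forall x y, adj x y -> (x, y) \in arcs E \/ x \in fz /\ y \in fz.
Hypothesis fz_stick : stick None fz.
Hypothesis EK : size E <= K.

(** The height and the candidate have a meaning only while [act] holds, the candidate only while the
    stack is high enough; it is rewritten whenever its height is reached again. The unconditional
    bounds keep stale values within the word size. *)
Record dfs_mem act nw stk vis p m : Prop := DfsMem {
  dm_search : search None adj fz act nw stk vis p;
  dm_state : state q fz E p m;
  dm_vis : marks m 1 (mem vis);
  dm_run : var m xrun = (stk != [::]);
  dm_cur : stk != [::] -> var m xcur = code (head None stk);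
  dm_act : var m xact = act;
  dm_len : act -> var m xlen = size stk - size fz;
  dm_len_le : var m xlen <= n;
  dm_new : var m xnew = code nw;
  dm_cand_le : var m xcand <= n;
  dm_cand : act -> 0 < freeze_len fz -> size fz + freeze_len fz <= size stk ->
    var m xcand = code (cand None fz stk)
}.

Lemma dfs_mem_same act nw stk vis p m m' :
  same n [:: xnext; xi] m m' -> dfs_mem act nw stk vis p m ->
  dfs_mem act nw stk vis p m'.
Proof.
move=> sm H; have [_ e1 _ e3] := sm.
split; rewrite ?e3 //; try by case: H.
- by apply: same_state sm (dm_state H).
- by move=> x; rewrite e1 // (dm_vis H).
Qed.

Lemma freeze_len_b m p : state q fz E p m -> var m xb %/ 2 = freeze_len fz.
Proof. by move/state_b => ->; rewrite /freeze_len card_vertices. Qed.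

Lemma branch_len_b m p :
  state q fz E p m -> var m xb %/ 2 + var m xb %/ 4 = branch_len fz.
Proof. by move/state_b => ->; rewrite /branch_len card_vertices. Qed.

Lemma wp_push act nw u y st vis p m Q :
  dfs_mem act nw (u :: st) vis p m -> adj u y -> y \notin vis ->
  var m xnext = code y ->
  (forall m' nw' p', dfs_mem act nw' [:: y, u & st] (y |: vis) p' m' -> Q m') ->
  wp S W push Q m.
Proof.
move=> H uy yv my HQ; have sm := dm_state H; have m0 := state_size sm.
have Hs := search_push fz_stick (dm_search H) uy yv; rewrite /= in Hs.
set p' := finfun _ in Hs.
have mu : var m xcur = code u by rewrite (dm_cur H).
have I' := dfs_reachP (search_reach Hs).
have I := dfs_reachP (search_reach (dm_search H)).
have := uniq_size (dfs_uniq I') => /= sst.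
have y0 : y != None by apply: contraNneq yv => ->; exact: dfs_root_vis I.
have [ule yle] := (code_le u, code_le y).
wp_set; rewrite ?my ?mu //; try lia.
wp_set; rewrite ?var_setpar ?m0 ?my //; try lia.
wp_set; rewrite ?var_setpar ?m0 ?my //; try lia.
set m3 := setvar _ xcur _.
have m30 : m3 0 = n by rewrite /m3 !cellE.
have var3 g : var m3 g = if g == xcur then code y else var m g.
  by rewrite /m3 !getE // var_setpar ?m0.
have st3 : state q fz E p' m3.
  case: sm => _ s1 s2 s3 [s4 s5] [s6 s7]; split=> //; rewrite ?var3 //.
  - by move=> x; rewrite /m3 !getE //= arr_setpar ?m0.
  - by split; rewrite ?var3 // => i /s5; rewrite /m3 !getE //= !arr_setpar ?m0.
  - split=> [|x z]; first by rewrite ffunE eq_sym (negbTE y0).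
    rewrite ffunE /m3 par_setvar ?par_setarr ?cellE ?m0 ?code_le // par_setpar code_eq.
    by case: eqP => [_ [<-] //|_]; apply: s7.
have vis3 : marks m3 1 (mem (y |: vis)).
  move=> x; rewrite /m3 !getE //= code_eq arr_setpar ?m0 //.
  by rewrite (dm_vis H) in_setU1; case: eqP.
have sizes : act -> size fz <= size (u :: st).
  by move=> actT; have [pre -> _] := search_act (dm_search H) actT; rewrite size_cat leq_addl.
have k0 := k_gt0 fz_stick.
apply: wp_seqs; apply: wp_if; rewrite evE var3 /= (dm_act H) => actE; last first.
  have act0 : act = false by case: act actE {H Hs HQ sizes}.
  apply: wp_skip; apply: wp_seqs0; apply: (HQ _ nw p'); split; rewrite ?var3 ?act0 //=.
  - by rewrite act0 in Hs.
  - by rewrite (dm_run H).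
  - by rewrite (dm_act H) act0.
  - exact: dm_len_le H.
  - exact: dm_new H.
  - exact: dm_cand_le H.
have actT : act by case: act actE {H Hs HQ sizes}.
have {}sizes := sizes actT.
have len3 := dm_len H actT.
have lenE : (var m xlen).+1 = (size st).+2 - size fz.
  by rewrite len3 subSn.
have lenn : (size st).+2 - size fz <= n.
  by rewrite leq_subLR; apply: leq_trans sst _; rewrite -add1n leq_add2r.
apply: wp_mark; rewrite ?var3 //=.
- by rewrite lenE.
- exact: dm_cand_le H.
move=> m4 sm4 len4 cand4 new4; apply: wp_seqs0.
have h4 : ((size st).+2 - size fz == freeze_len fz) = ((size st).+2 == size fz + freeze_len fz).
  by rewrite -(eqn_add2l (size fz)) subnKC // ltnW.
have t4 : ((size st).+2 - size fz == branch_len fz) = ((size st).+2 == size fz + branch_len fz).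
  by rewrite -(eqn_add2l (size fz)) subnKC // ltnW.
rewrite (freeze_len_b sm) lenE h4 in cand4.
rewrite (branch_len_b sm) lenE t4 in new4.
have [_ e1 _ e3] := sm4.
(* Either the new top is at height [h], or the entry at that height, counted from the root, is
   unaffected by the push. *)
have candP : 0 < freeze_len fz -> size fz + freeze_len fz <= (size st).+2 ->
    var m4 xcand = code (cand None fz [:: y, u & st]).
  move=> h0; rewrite leq_eqVlt eq_sym cand4 /cand rev_cons nth_rcons size_rev.
  case: eqP => [e _|_ /= lt].
    by rewrite ifN ?ifT //=; lia.
  by rewrite (dm_cand H actT h0 lt) ifT //; lia.
apply: (HQ _ _ p'); split; first exact: Hs.
- exact: same_state sm4 st3.
- by move=> x; rewrite e1 // vis3.
- by rewrite e3 // var3 (dm_run H).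
- by rewrite e3 // var3.
- by rewrite e3 // var3 (dm_act H).
- by rewrite len4 lenE.
- by rewrite len4 lenE.
- rewrite new4 actT; case: ifP => [/eqP e|_]; last exact: dm_new H.
  apply: candP; last by rewrite e leq_add2l leq_addr.
  move: e lenE; rewrite /branch_len /freeze_len; lia.
- by rewrite cand4; case: ifP => // _; exact: dm_cand_le H.
- by [].
Qed.

Lemma wp_pop act nw u st vis p m Q :
  dfs_mem act nw (u :: st) vis p m -> (forall v, adj u v -> v \in vis) ->
  (forall m', dfs_mem (act && (u != q)) nw st vis p m' -> Q m') ->
  wp S W pop Q m.
Proof.
move=> H uv HQ; have sm := dm_state H; have m0 := state_size sm.
have Hs := search_pop fz_stick (dm_search H) uv.
have mu : var m xcur = code u by rewrite (dm_cur H).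
have I := dfs_reachP (search_reach (dm_search H)).
set vs := [:: xact; xlen; xcur; xrun].
have sS m1 g x : g \in vs -> same n vs m m1 -> same n vs m (setvar m1 g x).
  exact: same_setvar.
have len_le := dm_len_le H.
apply: wp_seqs; apply: (wp_mono (Q := fun m1 => [/\ same n vs m m1,
    var m1 xact = act && (u != q) & forall g, g != xact -> var m1 g = var m g])).
  move=> m1 [sm1 act1 var1].
  have m10 : m1 0 = n by case: sm1 => ->.
  wp_set; rewrite ?var1 //; try lia.
  set m2 := setvar m1 xlen _.
  have m20 : m2 0 = n by rewrite /m2 !cellE.
  have sm2 : same n vs m m2 by exact: sS.
  have var2 g : var m2 g = if g == xlen then var m xlen - 1 else
      if g == xact then (act && (u != q) : nat) else var m g.
    rewrite /m2 !getE; case: eqP => // _; case: eqP => [-> //|/eqP]; exact: var1.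
  (* What remains to be checked is the same whether or not the root is popped. *)
  have done_pop m' : same n vs m m' -> var m' xact = act && (u != q) ->
      var m' xlen = var m xlen - 1 -> var m' xrun = (st != [::]) ->
      (st != [::] -> var m' xcur = code (head None st)) -> Q m'.
    move=> sm' act' len' run' cur'; have [_ e1 _ e3] := sm'.
    apply: HQ; split=> //.
    - exact: same_state sm' sm.
    - by move=> x; rewrite e1 // (dm_vis H).
    - case/andP=> actT _; rewrite len' (dm_len H actT) /=.
      by have gen a b : a.+1 - b - 1 = a - b; [lia | exact: gen].
    - by rewrite len'; lia.
    - by rewrite e3 // (dm_new H).
    - by rewrite e3 // (dm_cand_le H).
    - case/andP=> actT _ h0 lt; rewrite e3 // (dm_cand H actT h0) //=; last exact: leqW.
      rewrite /cand rev_cons nth_rcons size_rev ifT // prednK ?addn_gt0 ?h0 ?orbT //.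
  apply: wp_seqs; apply: wp_if; rewrite !evE var2 /= mu => u0.
  - have {}u0 : u != None by rewrite -code_eq0.
    have [v pu st0] : exists2 v, p u = Some v & v = head None st /\ st != [::].
      have := dfs_last I isT; have := dfs_chain I.
      case: st {H HQ Hs I done_pop len_le} => [_ /= e|v st /= /andP[/eqP pu _] _].
        by rewrite e in u0.
      by exists v.
    apply: (wp_setvar K12 nK); rewrite ?evE //.
      have [_ _ e2 _] := sm2.
      rewrite var2 /= mu e2 ?code_le //; case: (state_parents sm) => _ /(_ _ _ pu) ->.
      by have := code_le v; lia.
    have [_ _ e2 _] := sm2.
    apply: wp_seqs0; apply: done_pop; rewrite ?getE //=; first exact: sS.
      by rewrite var1 // (dm_run H); case: st0 => _ ->.
    rewrite var1 // mu e2 ?code_le // => _; case: (state_parents sm) => _ /(_ _ _ pu) ->.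
    by case: st0 => <-.
  - have {}u0 : u = None by apply/eqP; rewrite -code_eq0 u0.
    have st0 : st = [::].
      have := dfs_chain I; rewrite u0; case: st {H HQ Hs I done_pop len_le} => //= v st.
      by case: (state_parents sm) => pN _; rewrite /chain pN.
    apply: (wp_setvar K12 nK); rewrite ?evE //; first by lia.
    apply: wp_seqs0; apply: done_pop; rewrite ?getE //=; first exact: sS.
      by rewrite st0.
    by rewrite st0.
apply: wp_if; rewrite !evE mu (state_q sm) code_eq.
- rewrite eqb0 negbK => uq; apply: (wp_setvar K12 nK); rewrite ?evE //; first by lia.
  split; rewrite ?getE //= ?uq ?andbF //; first exact: sS.
  by move=> g /negbTE ga; rewrite getE ga.
- move/eqP; rewrite eqb0 => uq; apply: wp_skip; split=> //.
  by rewrite (dm_act H) uq andbT.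
Qed.

Lemma wp_dfs p m Q :
  state q fz E p m -> sorted (chain p) fz -> (forall x y, p x = Some y -> adj y x) ->
  marks m 1 (mem fz) -> var m xcur = code q -> var m xlen = 0 -> var m xact = 1 ->
  var m xcand = 0 -> var m xnew = 0 -> var m xrun = 1 ->
  (forall act nw vis p' m', dfs_mem act nw [::] vis p' m' -> Q m') ->
  wp S W traverse Q m.
Proof.
move=> sm cp pa mv cur len act ca nw run HQ.
pose G := (bool * V * seq V * {set V} * {ffun V -> option V})%type.
apply: (wp_while (G := G) (g := (true, None, fz, [set x in fz], restrict fz p))
  (I := fun '(act, nw, stk, vis, p) => dfs_mem act nw stk vis p)
  (mu := fun '(act, nw, stk, vis, p) => 2 * #|~: vis| + size stk)).
- split; rewrite ?cur ?len ?act ?ca ?nw ?run //.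
  + by apply: search_init => //; case: (state_parents sm).
  + case: sm => s0 s1 s2 s3 s4 [s5 s6]; split=> //; split=> [|x y].
      by rewrite ffunE s5; case: ifP.
    by rewrite ffunE; case: ifP => // _; apply: s6.
  + by move=> x; rewrite mv inE.
  + by case: fz_stick => _ ->.
  + by rewrite subnn.
  + by move=> _ h0; rewrite -[X in _ <= X]addn0 leq_add2l leqNgt h0.
- move=> {p m sm cp pa mv cur len act ca nw run} [[[[act nw] stk] vis] p] m H.
  rewrite evE (dm_run H) eqb0 negbK => stk0.
  case: stk stk0 H => // u st _ H.
  have I := dfs_reachP (search_reach (dm_search H)).
  apply: wp_seq; apply: (wp_find_next K12 nK KW (dm_state H) EK (dm_vis H)) => //.
  - exact: dfs_root_vis I.
  - by rewrite (dm_cur H).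
  move=> y m1 sm1 my yP; have H1 := dfs_mem_same sm1 H.
  apply: wp_if; rewrite evE my => y0.
  + have {}y0 : y != None by rewrite -code_eq0.
    have [yv uy] : y \notin vis /\ (u, y) \in arcs E by case: y y0 yP {my}.
    apply: (wp_push H1 (arcs_adj uy) yv my) => m2 nw2 p2 H2.
    exists (act, nw2, [:: y, u & st], y |: vis, p2) => //=.
    have -> : #|~: vis| = #|~: (y |: vis)|.+1.
      apply/eqP; rewrite -(eqn_add2l #|vis|) cardsC -(cardsC (y |: vis)) cardsU1 yv.
      by rewrite add1n addSnnS.
    by have gen a s : 2 * a + s.+2 < 2 * a.+1 + s.+1; [lia | exact: gen].
  + have {}y0 : y = None by apply/eqP; rewrite -code_eq0 y0.
    rewrite y0 /= in yP.
    apply: (wp_pop H1) => [v uv|m2 H2].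
      (* A neighbour along a forgotten edge is frozen, hence visited from the start. *)
      have [/yP //|[_ vf]] := adj_arcs uv.
      exact: search_fz (dm_search H) _ vf.
    by exists (act && (u != q), nw, st, vis, p) => //=; rewrite addnS.
- move=> {p m sm cp pa mv cur len act ca nw run} [[[[act nw] stk] vis] p] m H.
  rewrite evE (dm_run H) => /eqP; rewrite eqb0 negbK => /eqP e; rewrite e in H.
  exact: HQ H.
Qed.

End Dfs.
End Search_loop.

(** * Freezing, compaction and initialisation *)

Section Update.
Variables n K W : nat.
Hypotheses (K12 : 12 <= K) (nK : n < K) (KW : K < W).
Let S := n + (5 * K + 3).
Notation V := (option 'I_n).
Notation code := (@vertex_code n).
Notation d0 := (None, None).
Implicit Types (m : Defs.mem) (E : seq (V * V)) (p : {ffun V -> option V}).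
Implicit Types (q : V) (fz st : seq V) (vis : {set V}).

Lemma state_rcons q fz E p m m' e :
  m' 0 = m 0 -> (forall x, arr m' 0 (code x) = arr m 0 (code x)) ->
  var m' xq = var m xq -> var m' xb = var m xb -> var m' xcnt = (size E).+1 ->
  (forall i, i <= size E -> arr m' 2 i = if i == size E then code e.1 else arr m 2 i) ->
  (forall i, i <= size E -> arr m' 3 i = if i == size E then code e.2 else arr m 3 i) ->
  (forall k, k <= n -> par m' k = par m k) ->
  state q fz E p m -> state q fz (rcons E e) p m'.
Proof.
move=> e0 e1 e2 e3 e4 e5 e6 e7 [s0 s1 s2 s3 [s4 s5] [s6 s7]].
split; rewrite ?e0 ?e2 ?e3 //.
- by move=> x; rewrite e1.
- split=> [|i]; rewrite size_rcons // ltnS => iE; rewrite e5 // e6 // nth_rcons.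
  by case: ltngtP iE => // iE _; apply: s5.
- by split=> // x y /s7 <-; rewrite e7 // code_le.
Qed.

Lemma stick_rooted_path (p : {ffun V -> option V}) (adj : rel V) nw tail :
  (forall x y, p x = Some y -> adj y x) -> sorted (chain p) (rcons tail nw) ->
  path adj nw (rev tail).
Proof.
move=> pa; rewrite -[path _ _ _]/(sorted adj (nw :: rev tail)) -rev_rcons rev_sorted.
by apply: sub_sorted => x y /eqP /pa.
Qed.

(** The lower [h] vertices [mid] of the branch are frozen. The upper [b %/ 4] vertices [tail] hang
    below the new end and witness [reachable_outside] for it, since they number at least one eighth
    of what remains unfrozen. *)
Lemma branch_freeze (adj : rel V) fz p vis nw :
  (forall x y, p x = Some y -> adj y x) -> stick None fz -> branch None fz p vis nw ->
  exists2 mid, size mid = freeze_len fz & let fz' := mid ++ fz in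
  [/\ stick None fz', sorted (chain p) fz', head None fz' = nw
    & reachable_outside None adj fz'].
Proof.
move=> pa fzS [h0 pre upre cpre _ spre nwE].
set h := freeze_len fz in h0 *.
have hT : branch_len fz - h = (#|{: V}| - size fz) %/ 4 by rewrite /branch_len addKn.
have hT' : h <= branch_len fz by rewrite /branch_len leq_addr.
pose tail := take (branch_len fz - h) pre; pose mid := drop (branch_len fz - h) pre.
have smid : size mid = h by rewrite size_drop spre subKn.
have epre : pre = tail ++ mid by rewrite cat_take_drop.
have stail : size tail = branch_len fz - h by rewrite size_takel // spre leq_subr.
exists mid => //= ; set fz' := mid ++ fz.
have efz : pre ++ fz = tail ++ fz' by rewrite epre catA.
have fz'0 : fz' != [::] by rewrite -size_eq0 size_cat smid; lia.
have headE : head None fz' = nw.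
  rewrite nwE /cand nth_rev ?size_cat ?spre; last by lia.
  rewrite efz nth_cat stail.
  have -> : branch_len fz + size fz - (size fz + h).-1.+1 = branch_len fz - h by lia.
  by rewrite ltnn subnn nth0.
have utail : {in tail, forall x, x \notin fz'}.
  move: upre; rewrite efz cat_uniq => /and3P[_ /hasPn tf _] x xt.
  by apply/negP => /tf; rewrite /= xt.
split=> //.
- split=> //; first by move: upre; rewrite efz cat_uniq => /and3P[].
  by case: fzS => _ fz0 lf; rewrite last_cat -[RHS]lf; case: (fz) fz0.
- by have := drop_sorted (size tail) cpre; rewrite efz drop_size_cat.
exists [set x in tail].
  have /card_uniqP ut : uniq tail.
    by move: upre; rewrite efz cat_uniq => /and3P[].
  rewrite cardsE ut stail hT size_cat smid /h /freeze_len.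
  by have gen a k : (a - ((a - k) %/ 2 + k)) %/ 8 <= (a - k) %/ 4; [lia | exact: gen].
move=> x; rewrite inE headE => xt.
have pt : path adj nw (rev tail).
  apply: (stick_rooted_path (p := p)) => //.
  move: cpre; rewrite efz -headE; case: (fz') fz'0 => // y s _.
  by rewrite -cat_rcons => /cat_sorted2[].
have xr : x \in rev tail by rewrite mem_rev.
exists (take (index x (rev tail)).+1 (rev tail)); split.
- exact: take_path.
- by rewrite (take_nth None) ?index_mem // last_rcons nth_index.
- exact: utail.
- by move=> y /mem_take; rewrite mem_rev; apply: utail.
Qed.

Lemma wp_freeze (adj : rel V) fz E act nw vis p m Q :
  stick None fz -> dfs_mem adj fz E act nw [::] vis p m ->
  (forall fz' m', state (head None fz') fz' E p m' -> stick None fz' ->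
     sorted (chain p) fz' -> {subset fz <= fz'} ->
     fz' = fz \/ reachable_outside None adj fz' -> size fz <= size fz' ->
     (must_freeze None adj fz -> size fz' = size fz + freeze_len fz) -> Q m') ->
  wp S W freeze Q m.
Proof.
move=> fzS H HQ; have sm := dm_state H; have Hs := dm_search H.
have I := dfs_reachP (search_reach Hs).
apply: wp_if; rewrite evE (dm_new H) => nw0; last first.
  have {}nw0 : nw = None by apply/eqP; rewrite -code_eq0 nw0.
  apply: wp_skip; apply: (HQ fz) => //.
  - exact: search_chain Hs.
  - by left.
  - by move/(search_end fzS Hs); rewrite nw0.
have {}nw0 : nw != None by rewrite -code_eq0.
have pa x y : p x = Some y -> adj y x by move=> /(dfs_parent I)[].
have [mid smid [/= fz'S cp hd R]] := branch_freeze pa fzS (search_new Hs nw0).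
set s := mid ++ fz in fz'S cp hd R.
have us := stick_uniq fz'S.
have hs : freeze_len fz < size s.
  by rewrite size_cat smid -addn1 leq_add2l; apply: k_gt0 fzS.
have szs : size s <= n.+1 by exact: uniq_size.
have m0 := state_size sm; have nwle := code_le nw.
wp_set; rewrite ?(dm_new H) //; try lia.
(* Marking proceeds from the new end towards the root, so [take i mid ++ fz] need not be a path
   before the loop ends. Uniqueness of [mid ++ fz] makes the loop stop exactly at the old frozen
   path. *)
apply: wp_seqs; apply: (wp_while (G := nat) (g := 0) (mu := fun i => freeze_len fz - i)
  (I := fun i m => [/\ state (head None fz) (take i mid ++ fz) E p m, i <= freeze_len fz,
     var m xcur = code (nth None s i) & var m xnew = code nw])).
- split=> //; rewrite ?getE //; last exact: dm_new H.
    by rewrite take0; apply: state_eq sm; simp_mem.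
  by rewrite nth0 hd.
- move=> i {HQ H sm Hs I m0}m [sm ih cur new]; have m0 := state_size sm.
  rewrite !evE cur (state_fro sm) eqb0 => xN.
  have {}xN : nth None s i \notin take i mid ++ fz by case: (_ \in _) xN.
  have {ih} ih : i < freeze_len fz.
    rewrite ltn_neqAle ih andbT; apply: contraNneq xN => ->.
    rewrite nth_cat smid ltnn subnn mem_cat nth0 q_fz ?orbT //.
  have is_ : i < size mid by rewrite smid.
  have xs : nth None s i = nth None mid i by rewrite nth_cat is_.
  have xle := code_le (nth None s i).
  have us' : uniq (nth None s i :: take i mid ++ fz).
    rewrite /= xN; apply: subseq_uniq us; rewrite /s -{2}(cat_take_drop i mid) -catA.
    by apply: cat_subseq => //; apply: suffix_subseq.
  have := uniq_size us' => /= szi.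
  have isz : i.+1 < size s by apply: leq_ltn_trans hs.
  have pi : p (nth None s i) = Some (nth None s i.+1).
    by apply/eqP; apply: (sortedP None cp).
  have [_ /(_ _ _ pi) pari] := state_parents sm.
  have sz1 : size (take i.+1 mid ++ fz) = (size (take i mid ++ fz)).+1.
    by rewrite !size_cat !size_takel // ltnW.
  have in1 x : (x \in take i.+1 mid ++ fz) = (x == nth None s i) || (x \in take i mid ++ fz).
    by rewrite (take_nth None) // cat_rcons !mem_cat inE -xs orbCA.
  wp_set; rewrite ?cur //; try lia.
  wp_set; rewrite ?(state_b sm) //; try lia.
  have nle := code_le (nth None s i.+1).
  wp_set; rewrite ?cur //; try by rewrite !par_setarr ?par_setvar ?cellE ?m0 // pari; lia.
  apply: wp_seqs0; exists i.+1; last by lia.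
  split; rewrite ?getE //=; last by rewrite !par_setvar ?par_setarr ?cellE ?m0.
  case: sm => _ s1 s2 s3 [s4 s5] [s6 s7]; split; rewrite ?getE ?cellE //=.
  + by move=> x; rewrite !getE //= code_eq in1 s1; case: eqP.
  + by rewrite sz1; have gen a b : a - b - 1 = a - b.+1; [lia | exact: gen].
  + by split; rewrite ?getE // => j /s5; rewrite !getE.
  + by split=> // x y /s7 <-; rewrite !par_setvar ?par_setarr ?cellE ?m0 // code_le.
move=> i {m H sm m0 nwle} m [sm ih cur new]; have m0 := state_size sm.
rewrite !evE cur (state_fro sm) eqb0 => xN.
have {xN} xin : nth None s i \in take i mid ++ fz by case: (_ \in _) xN.
have {xin} ih' : i = freeze_len fz.
  apply/eqP; move: ih; rewrite leq_eqVlt => /orP[//|ih].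
  have is_ : i < size mid by rewrite smid.
  have : uniq (take i.+1 mid ++ fz).
    apply: subseq_uniq us; rewrite /s -{2}(cat_take_drop i.+1 mid) -catA.
    by apply: cat_subseq => //; apply: suffix_subseq.
  rewrite (take_nth None) // cat_rcons -cat1s uniq_catCA cat1s cons_uniq.
  by move: xin; rewrite nth_cat is_ => ->.
have nwle := code_le nw; wp_set; rewrite ?new; try lia.
apply: wp_seqs0; apply: (HQ s) => //.
- rewrite hd; case: sm => _ s1 s2 s3 [s4 s5] [s6 s7]; rewrite ih' -smid take_size -/s in s1 s3.
  split; rewrite ?getE ?cellE //.
  + by move=> x; rewrite !getE.
  + by split; rewrite ?getE // => j /s5; rewrite !getE.
  + by split=> // x y /s7 <-; rewrite !par_setvar ?m0 // code_le.
- by move=> x xf; rewrite mem_cat xf orbT.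
- by right.
- by rewrite size_cat leq_addl.
- by move=> _; rewrite size_cat smid addnC.
Qed.

Definition keep fz (e : V * V) : bool := ~~ ((e.1 \in fz) && (e.2 \in fz)).

Lemma wp_compact q fz E p m Q :
  state q fz E p m -> size E <= K ->
  (forall m', state q fz [seq e <- E | keep fz e] p m' -> Q m') ->
  wp S W compact Q m.
Proof.
move=> sm EK HQ; have m0 := state_size sm; have [cnt _] := state_entries sm.
wp_set; wp_set.
(* In-place filtering: the first [xj] entries, seen as the whole list by overriding [xcnt], are the
   kept ones, and [xj <= xi] protects the entries not yet read. *)
apply: wp_seqs; apply: (wp_while (G := nat) (g := 0) (mu := fun i => size E - i)
  (I := fun i m => [/\
    state q fz [seq e <- take i E | keep fz e] p (setvar m xcnt (var m xj)),
    var m xi = i /\ i <= size E, var m xcnt = size E, var m xj <= i &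
    forall i', i <= i' < size E ->
      arr m 2 i' = code (nth d0 E i').1 /\ arr m 3 i' = code (nth d0 E i').2])).
- split; rewrite ?getE //=.
  + case: sm => _ s1 s2 s3 [s4 s5] [s6 s7]; split; rewrite ?getE ?cellE //=.
    * by move=> x; rewrite !getE.
    * by split; rewrite ?getE take0.
    * by split=> // x y /s7 <-; rewrite !par_setvar ?cellE ?m0 // code_le.
  + move=> i iE; rewrite !getE //.
    by case: (state_entries sm) => _; apply.
- move=> i {sm cnt m0}m [sm [mi iE] cnt ji ent].
  have m0 : m 0 = n by have := state_size sm; rewrite cellE.
  rewrite !evE mi cnt; case: ltnP => // {}iE _.
  have [|m2 m3] := ent i; first by rewrite leqnn.
  have fro x : arr m 0 (code x) = (x \in fz) by have := state_fro sm x; rewrite getE.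
  have sizeE := proj1 (state_entries sm); rewrite !getE /= in sizeE.
  have takeS : take i.+1 E = rcons (take i E) (nth d0 E i) by rewrite (take_nth d0).
  have [le1 le2] := (code_le (nth d0 E i).1, code_le (nth d0 E i).2).
  apply: wp_seqs; apply: wp_if; rewrite !evE mi m2 m3 !fro => kp.
  + apply: wp_skip.
    wp_set; rewrite ?mi //; try lia.
    apply: wp_seqs0; exists i.+1; last by lia.
    split; rewrite ?getE ?addn1 //=.
    * rewrite takeS filter_rcons /keep ifN; last by case: (_ \in _) kp; case: (_ \in _).
      by apply: state_eq sm; simp_mem.
    * exact: leqW.
    * by move=> i' /andP[ii' i'E]; rewrite !getE //; apply: ent; rewrite ltnW.
  + wp_set; rewrite ?mi ?m2 //; try lia.
    wp_set; rewrite ?mi //= ?m3; try lia.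
    wp_set; try lia.
    apply: wp_seqs0.
    wp_set; rewrite /= ?mi; try lia.
    apply: wp_seqs0; exists i.+1; last by lia.
    split; rewrite ?getE ?addn1 //=.
    * rewrite takeS filter_rcons /keep ifT; last by case: (_ \in _) kp; case: (_ \in _).
      apply: state_rcons sm; rewrite ?getE -?sizeE ?addn1 //=; try by simp_mem.
    * by move=> i' /andP[ii' i'E]; rewrite !getE //= !ifN; [apply: ent; rewrite ltnW | lia | lia].
move=> i {sm cnt m0}m [sm [mi iE] cnt ji ent].
have m0 : m 0 = n by have := state_size sm; rewrite cellE.
rewrite !evE mi cnt; case: ltnP => // iE' _.
wp_set; try lia.
by apply: wp_seqs0; apply: HQ; rewrite take_oversize in sm.
Qed.

Definition root_arcs : seq (V * V) := [seq (None, Some i) | i <- enum 'I_n].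

Lemma wp_start Q :
  (forall m, state None [:: None] root_arcs [ffun=> None] m ->
     (forall k, 0 < k <= n -> par m k = 0) -> Q m) ->
  wp S W start Q (mem_start n).
Proof.
move=> HQ; set m := mem_start n; have m0 : m 0 = n by [].
have arr0 j i : arr m j i = 0.
  by rewrite /arr /loc /m /mem_start updE; case: eqP => //; lia.
have par0 k : par m k = 0 by [].
have sroot : size root_arcs = n by rewrite size_map size_enum_ord.
wp_set; try lia. wp_set; rewrite ?m0; try lia.
apply: wp_seqs; apply: (wp_while (G := nat) (g := 0) (mu := fun i => n - i)
  (I := fun i m => [/\ state None [:: None] (take i root_arcs) [ffun=> None] m, i <= n &
     forall k, 0 < k <= n -> par m k = 0])).
- split=> //.
  + split; rewrite ?getE ?cellE //=.
    * move=> x; rewrite !getE //= code_eq0 inE arr0; by case: eqP.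
    * exact: arr0.
    * by rewrite subn1.
    * by split; rewrite ?getE ?take0 //; exact: arr0.
    * by split=> [|x y]; rewrite ffunE.
  + by move=> k /andP[k0 kn]; rewrite par_setvar ?par_setarr ?cellE.
- move=> i {par0 arr0 m0}m [sm iN parm]; have m0 := state_size sm.
  have [cnt _] := state_entries sm.
  rewrite !evE m0 cnt size_takel ?sroot //; rewrite size_takel ?sroot // in cnt.
  case: ltnP => // {}iN _.
  wp_set; rewrite ?cnt; try lia.
  wp_set; rewrite ?cnt; try lia.
  wp_set; rewrite ?cnt; try lia.
  apply: wp_seqs0; exists i.+1; last by lia.
  split=> //; last by move=> k /andP[k0 kn]; rewrite par_setvar ?par_setarr ?cellE ?m0 // parm ?k0.
  rewrite (take_nth d0) ?sroot // (nth_map (Ordinal iN)) ?size_enum_ord //.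
  have -> : nth (Ordinal iN) (enum 'I_n) i = Ordinal iN by apply: val_inj; rewrite /= nth_enum_ord.
  apply: state_rcons sm; rewrite ?size_takel ?sroot; try by simp_mem.
  + by rewrite getE addn1.
  + by move=> j _; rewrite !getE //= addn1.
move=> i {par0 arr0 m0}m [sm iN parm]; have m0 := state_size sm.
have [cnt _] := state_entries sm.
rewrite !evE m0 cnt size_takel ?sroot //; case: ltnP => // ni _.
apply: wp_seqs0; apply: HQ parm.
by rewrite take_oversize ?sroot in sm.
Qed.

End Update.

(** * Maintaining the tree along a stream *)

Section Stream.
Variables n K W : nat.
Hypotheses (K12 : 12 <= K) (nK : n < K) (KW : K < W).
Let S := n + (5 * K + 3).
Notation V := (option 'I_n).
Notation code := (@vertex_code n).
Implicit Types (m : Defs.mem) (E : seq (V * V)) (es : seq (edge n)) (e : edge n).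
Implicit Types (p : {ffun V -> option V}) (fz : seq V).

Definition edge_arc e : V * V := (Some (val e).1, Some (val e).2).

Definition all_arcs es : seq (V * V) := root_arcs n ++ map edge_arc es.

Lemma mem_arcs E x y : ((x, y) \in arcs E) = ((x, y) \in E) || ((y, x) \in E).
Proof.
elim: E => [//|[a b] E IH]; rewrite /arcs /= !inE -/(arcs E) IH !xpair_eqE.
by rewrite (andbC (y == a)) -!orbA; congr (_ || _); apply: orbCA.
Qed.

Lemma aug_adjE es x y :
  aug_adj es x y = ((x, y) \in all_arcs es) || ((y, x) \in all_arcs es).
Proof.
have rootP z : ((None, Some z) \in root_arcs n) by apply: map_f; rewrite mem_enum.
have edgeP u v : ((Some u, Some v) \in all_arcs es) = has (fun e => val e == (u, v)) es.
  have -> : ((Some u, Some v) \in all_arcs es) = ((Some u, Some v) \in map edge_arc es).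
    by rewrite mem_cat; case: mapP => // -[].
  apply/mapP/hasP => [[e ees [-> ->]]|[e ees /eqP euv]]; exists e => //.
    by rewrite -surjective_pairing.
  by rewrite /edge_arc euv.
case: x y => [u|] [v|] /=.
- rewrite !edgeP -has_predU; apply: eq_has => e; by [].
- by rewrite /all_arcs !mem_cat rootP !orbT.
- by rewrite /all_arcs !mem_cat rootP.
- by apply/esym/negbTE; rewrite orbb mem_cat negb_or; apply/andP; split; apply/mapP => -[].
Qed.

Lemma all_arcs_rcons es e : all_arcs (rcons es e) = rcons (all_arcs es) (edge_arc e).
Proof. by rewrite /all_arcs map_rcons -rcons_cat. Qed.

Lemma aug_adj_rcons es e x y : aug_adj es x y -> aug_adj (rcons es e) x y.
Proof.
by rewrite !aug_adjE all_arcs_rcons !mem_rcons !inE => /orP[] ->; rewrite !orbT.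
Qed.

Lemma reachable_outside_sub (adj adj' : rel V) fz : subrel adj adj' ->
  reachable_outside None adj fz -> reachable_outside None adj' fz.
Proof.
move=> sub [R bR RP]; exists R => // x /RP[s [ps ls xf sf]].
by exists s; split=> //; apply: sub_path ps.
Qed.

(** [inv_reach] is carried along because freezing depends on it; further edges preserve it, and each
    freezing renews it. *)
Record invariant es fz m : Prop := Invariant {
  inv_p : {ffun V -> option V};
  inv_state : state (head None fz) fz [seq a <- all_arcs es | keep fz a] inv_p m;
  inv_stick : stick None fz;
  inv_chain : sorted (chain inv_p) fz;
  inv_tree : dfs_tree (aug_adj es) None inv_p;
  inv_reach : reachable_outside None (aug_adj es) fz
}.

Lemma dfs_tree_holds es p m :
  dfs_tree (aug_adj es) None p -> parents m p -> holds_tree m p.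
Proof.
move=> [vis /dfs_reachP I] [_ pm] v.
have vv : Some v \in vis by apply: (dfs_spanning I); case.
have := dfs_orphan I vv isT.
by case e: (p (Some v)) => [y|] // _; rewrite /= -(pm _ _ e).
Qed.

Lemma wp_step es fz m e :
  invariant es fz m -> size [seq a <- all_arcs es | keep fz a] < K ->
  wp S W step (fun m' => exists fz', [/\ invariant (rcons es e) fz' m',
    {subset fz <= fz'}, size fz <= size fz' &
    must_freeze None (aug_adj (rcons es e)) fz ->
    size fz' = size fz + freeze_len fz]) (mem_feed e m).
Proof.
move=> [p sm fzS cp [vis0 /dfs_reachP I0] R] szK.
set E := [seq _ <- _ | _] in sm szK; set es' := rcons es e.
have pa x y : p x = Some y -> aug_adj es' y x.
  by case/(dfs_parent I0) => yx _ _; apply: aug_adj_rcons.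
have R' : reachable_outside None (aug_adj es') fz.
  by apply: reachable_outside_sub R => x y; apply: aug_adj_rcons.
pose E' := rcons E (edge_arc e).
have subE : {subset E' <= all_arcs es'}.
  move=> a; rewrite all_arcs_rcons !mem_rcons !inE mem_filter.
  by case/orP=> [->//|/andP[_ ->]]; rewrite orbT.
have arcs_adj x y : (x, y) \in arcs E' -> aug_adj es' x y.
  by rewrite mem_arcs aug_adjE => /orP[] /subE ->; rewrite ?orbT.
have keepE x y : (x, y) \in all_arcs es' -> (x, y) \in E' \/ x \in fz /\ y \in fz.
  rewrite all_arcs_rcons !mem_rcons !inE mem_filter => /orP[->|xy]; first by left.
  rewrite xy andbT /keep /=; case: (boolP (_ && _)) => [/andP|]; first by right.
  by rewrite orbT; left.
have adj_arcs x y : aug_adj es' x y -> (x, y) \in arcs E' \/ x \in fz /\ y \in fz.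
  rewrite mem_arcs aug_adjE => /orP[] /keepE [->|[? ?]]; rewrite ?orbT; by [left | right].
have E'K : size E' <= K by rewrite size_rcons.
apply: wp_seqs; apply: (wp_record_edge K12 nK KW sm) => // m1 sm1.
apply: wp_seqs; apply: (wp_reset K12 nK KW sm1) => m2 sm2 mv cur len act ca new run.
apply: wp_seqs; apply: (wp_dfs K12 nK KW arcs_adj adj_arcs fzS E'K sm2) => //.
move=> act' nw vis p' m3 H.
have I := dfs_reachP (search_reach (dm_search H)).
apply: wp_seqs; apply: (wp_freeze K12 nK KW fzS H) => fz' m4 sm4 fz'S cp' sub reach le must.
apply: wp_seqs; apply: (wp_compact K12 nK KW sm4 E'K) => m5 sm5.
apply: wp_seqs0; exists fz'; split=> //; exists p' => //.
- suff <- : [seq a <- E' | keep fz' a] = [seq a <- all_arcs es' | keep fz' a] by [].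
  rewrite all_arcs_rcons !filter_rcons -filter_predI.
  have -> // : filter (predI (keep fz') (keep fz)) (all_arcs es) = filter (keep fz') (all_arcs es).
  apply: eq_filter => -[x y] /=; rewrite /keep /= -negb_or; congr negb.
  apply/orP/idP => [[//|/andP[/sub -> /sub ->]]|->]; by [|left].
- by exists vis; exact: search_reach (dm_search H).
- by case: reach => [->|].
Qed.

(** Each vertex is pushed from the root and popped at once; [gen] takes an arbitrary list of
    vertices handled so far. *)
Lemma dfs_star : dfs_tree (@aug_adj n [::]) None
  [ffun x => if x is Some _ then Some None else None].
Proof.
suff gen (s : seq 'I_n) : uniq s -> dfs_reach (@aug_adj n [::]) None [:: None]
    [set x : V | if x is Some v then v \in s else true]
    [ffun x => if x is Some v then (if v \in s then Some None else None) else None].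
  exists setT; apply: (@DfsPop _ _ _ None) => [|v _]; last by rewrite inE.
  have := gen _ (enum_uniq 'I_n).
  set A := finset _; set f := finfun _; set B := setT; set g := finfun _.
  have -> : A = B by apply/setP => -[v|]; rewrite !inE ?mem_enum.
  by have -> : f = g by apply/ffunP => -[v|]; rewrite !ffunE ?mem_enum.
elim: s => [_|v s IH /andP[vs us]].
  set A := finset _; set f := finfun _.
  have -> : A = [set None] by apply/setP => -[v|]; rewrite !inE.
  have -> : f = [ffun=> None] by apply/ffunP => -[v|]; rewrite !ffunE.
  exact: DfsStart.
have := DfsPush (IH us) (isT : aug_adj [::] None (Some v)) _; rewrite inE vs => /(_ isT).
set A := _ |: _; set f := finfun _; set B := finset _; set g := finfun _.
have -> : A = B by apply/setP => -[w|]; rewrite /A /B !inE.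
have -> : f = g.
  apply/ffunP => -[w|]; rewrite !ffunE //= inE.
  by rewrite -[Some w == Some v]/(w == v); case: eqP.
by move=> reach; apply: DfsPop reach _ => -[w|]; rewrite ?inE.
Qed.

(** The output cells are initially 0, the code of the pseudo root, so the memory already holds the
    star. *)
Lemma wp_start_invariant : wp S W start (invariant [::] [:: None]) (mem_start n).
Proof.
apply: (wp_start K12 nK KW) => m sm par0.
exists [ffun x => if x is Some _ then Some None else None] => //.
- case: sm => s0 s1 s2 s3 s4 _.
  have -> : [seq a <- all_arcs [::] | keep [:: None] a] = root_arcs n.
    rewrite /all_arcs cats0; by apply/all_filterP/allP => _ /mapP[i _ ->].
  split=> //; split=> [|[x|] y]; rewrite ffunE // => -[<-].
  by apply: par0; rewrite /= ltn_ord.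
- exact: dfs_star.
- exists [set x | x != None].
    have -> : [set x | x != None] = ~: [set None] :> {set V}.
      by apply/setP => x; rewrite !inE.
    by rewrite cardsC1 card_vertices /=; lia.
  move=> x; rewrite inE => x0; exists [:: x]; split; rewrite /= ?inE ?andbT //.
    by case: x x0.
  by move=> y; rewrite !inE => /eqP ->.
Qed.

(** The predicate [P] separates program correctness from the estimates: it has to bound the number
    of remembered edges and survive each arrival. It is used once with a bound on [b * k] and once
    trivially. *)
Lemma run_invariant es (P : nat -> seq V -> Prop) :
  P 0 [:: None] ->
  (forall k fz, k < size es -> stick None fz -> P k fz ->
     reachable_outside None (aug_adj (take k.+1 es)) fz ->
     size [seq a <- all_arcs (take k es) | keep fz a] < K /\
     forall fz', size fz <= size fz' ->
     (must_freeze None (aug_adj (take k.+1 es)) fz ->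
        size fz' = size fz + freeze_len fz) -> P k.+1 fz') ->
  maintains_dfs S W stick_dfs es.
Proof.
move=> P0 PS.
suff run k : k <= size es -> exists m fz,
    [/\ alg_run S W stick_dfs (take k es) m, invariant (take k es) fz m & P k fz].
  move=> k /run[m [fz [runm [p sm _ _ tree _] _]]]; exists m, p; split=> //.
  exact: (dfs_tree_holds tree (state_parents sm)).
elim: k => [_|k IH kes].
  have [m start_m inv] := wp_start_invariant.
  by exists m, [:: None]; rewrite take0; split=> //; exact: RunStart.
have [m [fz [runm inv Pk]]] := IH (ltnW kes).
have [e takeS] : exists e, take k.+1 es = rcons (take k es) e.
  by case: es kes {PS IH inv runm} => // e0 es' kes; exists (nth e0 (e0 :: es') k); apply: take_nth.
have [] := PS k fz kes (inv_stick inv) Pk.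
  by apply: reachable_outside_sub (inv_reach inv) => x y; rewrite takeS; apply: aug_adj_rcons.
move=> szK PS'.
have [m' step_m [fz' [inv' sub le must]]] := wp_step e inv szK.
rewrite -takeS in must inv'.
exists m', fz'; split=> //; last exact: PS'.
by rewrite takeS; apply: RunEdge runm step_m.
Qed.

End Stream.

Lemma maintains_dfs_mono S S' W A n (es : seq (edge n)) :
  S <= S' -> maintains_dfs S W A es -> maintains_dfs S' W A es.
Proof.
move=> SS' H k /H[m [p [run tree holds]]]; exists m, p; split=> //.
elim: run => {tree holds} [m' x|es' e m' m'' _ IH x].
  by apply: RunStart; apply: exec_mono x.
by apply: RunEdge IH _; apply: exec_mono x.
Qed.

(** * Two properties that keep the memory small *)

Section Good.
Variable n : nat.
Implicit Types (A B : {set 'I_n}) (es : seq (edge n)) (fz : seq (option 'I_n)).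

Definition touches B (e : edge n) : bool := ((val e).1 \in B) || ((val e).2 \in B).

Definition crosses A B (e : edge n) : bool :=
  (((val e).1 \in A) && ((val e).2 \in B)) || (((val e).1 \in B) && ((val e).2 \in A)).

(* Freezing uses sets of size [a = b %/ 8], so that [16 * a >= b].  The factor in
   [spread] makes the probability that two given sets of size [a] are not joined
   at most [n ^- (8 * a)], against [n ^ (2 * a)] pairs of sets; the one in
   [capacity] is such that too many edges at one set have probability at most
   [2 ^- capacity]. *)
Definition log_size : nat := (trunc_log 2 n).+1.
Definition spread : nat := 256 * 'C(n, 2) * log_size.
Definition capacity : nat := 2048 * n * log_size.

Definition expanding (k : nat) es : Prop :=
  forall a A B, 0 < a -> spread < 16 * a * k -> #|A| = a -> #|B| = a ->
    [disjoint A & B] -> has (crosses A B) (take k es).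

Definition sparse (k : nat) es : Prop :=
  forall B, #|B| * k <= spread -> count (touches B) (take k es) <= capacity.

Lemma bin2_ge : 1 < n -> n <= 2 * 'C(n, 2).
Proof.
move=> n1; rewrite mul2n bin2 -[n in n <= _]odd_double_half.
have := odd_double_half (n * n.-1); have : odd (n * n.-1) = false.
  by case: n => // k; rewrite oddM /= andNb.
move=> -> /=; rewrite add0n => ->.
by rewrite odd_double_half -[X in X <= _]muln1 leq_mul2l; lia.
Qed.

Definition unfrozen (fz : seq (option 'I_n)) : {set 'I_n} := [set v | Some v \notin fz].

Lemma card_unfrozen fz : stick None fz -> #|unfrozen fz| = n.+1 - size fz.
Proof.
move=> fzS; have := cardsC [set x in fz].
have -> : #|[set x in fz]| = size fz.
  by rewrite cardsE; apply/card_uniqP; apply: stick_uniq fzS.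
rewrite card_vertices => <-; rewrite addKn.
rewrite -(card_imset _ (@Some_inj _)); congr #|pred_of_set _|.
apply/setP => -[v|]; rewrite !inE.
  by rewrite mem_imset ?inE //; exact: Some_inj.
by rewrite (r_fz fzS); apply/negbTE/negP => /imsetP[].
Qed.

(** The pseudo root contributes at most [n] arcs, and any other kept edge has an unfrozen end. *)
Lemma size_kept fz es :
  size [seq a <- all_arcs es | keep fz a] <= n + count (touches (unfrozen fz)) es.
Proof.
rewrite /all_arcs filter_cat size_cat leq_add //.
  by rewrite size_filter (leq_trans (count_size _ _)) // size_map size_enum_ord.
rewrite size_filter count_map; apply: sub_count => e.
by rewrite /= /keep /touches /edge_arc /= negb_and !inE.
Qed.

Lemma well_joined_expanding k es a :
  expanding k es -> 0 < a -> spread < 16 * a * k ->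
  well_joined None (aug_adj (take k es)) a.
Proof.
move=> ex a0 ak F U Fa Ua FU NF NU.
have card1 (D : {set option 'I_n}) : None \notin D -> #|[set v | Some v \in D]| = #|D|.
  move=> ND; rewrite -(card_imset _ (@Some_inj _)); congr #|pred_of_set _|.
  apply/setP => -[v|]; first by rewrite mem_imset ?inE //; exact: Some_inj.
  by rewrite (negbTE ND); apply/negbTE/negP => /imsetP[].
have [] := hasP (ex a [set v | Some v \in F] [set v | Some v \in U] a0 ak _ _ _).
- by rewrite card1.
- by rewrite card1.
- rewrite -setI_eq0; apply/eqP/setP => v; rewrite !inE; apply/negP => /andP[vF vU].
  by move/pred0P: FU => /(_ (Some v)) /=; rewrite vF vU.
move=> e ees; rewrite /crosses !inE => /orP[]/andP[e1 e2].
  exists (Some (val e).1), (Some (val e).2); split=> //; apply/hasP; exists e => //.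
  by rewrite -surjective_pairing eqxx.
exists (Some (val e).2), (Some (val e).1); split=> //; apply/hasP; exists e => //.
by rewrite -surjective_pairing eqxx orbT.
Qed.

(** The invariant is [b * k <= spread n] with [b] unfrozen vertices. If the next edge would break
    it, [expanding] applies to sets of size [b %/ 8], freezing is forced, and [b] is halved. While
    it holds, [sparse] bounds the memory. *)
Lemma good_maintains W es :
  1 < n -> size es <= 'C(n, 2) ->
  (forall k, k <= size es -> expanding k es /\ sparse k es) ->
  n + capacity + 13 < W ->
  maintains_dfs (n + (5 * (n + capacity + 13) + 3)) W stick_dfs es.
Proof.
move=> n1 esN good KW; have N0 := bin2_ge n1.
have L0 : 0 < log_size by [].
have spreadN : 256 * 'C(n, 2) <= spread by rewrite /spread leq_pmulr.
apply: (@run_invariant n (n + capacity + 13) W _ _ _ es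
  (fun k fz => (n.+1 - size fz) * k <= spread)); try lia.
move=> k fz kes fzS bk R.
have [ex _] := good _ kes; have [_ sp] := good _ (ltnW kes).
split.
  have := size_kept fz (take k es); have := sp (unfrozen fz).
  by rewrite card_unfrozen // => /(_ bk); lia.
move=> fz' le must; set b := n.+1 - size fz in bk.
have [bk'|bk'] := leqP (b * k.+1) spread.
  by apply: leq_trans bk'; rewrite leq_mul2r leq_sub2l ?orbT.
have kN : k.+1 <= 'C(n, 2) by apply: leq_trans esN.
(* The product [b * k.+1] exceeds [256 * 'C(n, 2)] while [k.+1] is at most ['C(n, 2)]. *)
have b256 : 256 < b.
  have : b * k.+1 <= b * 'C(n, 2) by rewrite leq_mul2l kN orbT.
  by move=> bN; rewrite -(ltn_pmul2r (m := 'C(n, 2))); lia.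
have k2 : 2 <= k.
  rewrite leqNgt; apply/negP => k1.
  have : b * k.+1 <= b * 2 by rewrite leq_mul2l; lia.
  have : b <= n.+1 by exact: leq_subr.
  lia.
have bE : #|{: option 'I_n}| - size fz = b by rewrite card_vertices.
have {}must : size fz' = size fz + b %/ 2.
  rewrite must /freeze_len ?bE //; split=> //; rewrite ?bE; first by lia.
  have [b8 b16] : 0 < b %/ 8 /\ b <= 16 * (b %/ 8).
    by move: (b) b256 => c c256; lia.
  apply: (well_joined_expanding ex b8).
  by apply: leq_trans bk' _; rewrite leq_mul2r b16 orbT.
rewrite must subnDA -/b.
apply: leq_trans bk; move: b256 k2; clear; move=> b256 k2.
(* Rounding up costs at most one half, and [(b + 1) * (k + 1) <= 2 * b * k] for such [b] and [k]. *)
have : (b - b %/ 2) * 2 <= b + 1 by lia.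
nia.
Qed.

End Good.

(** * Uniformly random permutations *)

Section Perm.
Variable T : finType.
Implicit Types (A H X : {set T}) (s : {perm T}).

Lemma card_all_perm : #|{perm T}| = #|T|`!.
Proof.
rewrite -[in RHS]cardsT -card_perm; apply: eq_card => s.
by rewrite !inE; apply/esym/subsetP => x _; rewrite inE.
Qed.

Definition maps_into A H : {set {perm T}} := [set s : {perm T} | [forall x in A, s x \in H]].

Lemma maps_intoP A H s : reflect {in A, forall x, s x \in H} (s \in maps_into A H).
Proof. by rewrite inE; apply: forall_inP. Qed.

(* Both sides count the pairs of a permutation mapping [A] into [H] and a point
   outside [A] that it maps into [H]; composing with a transposition shows that
   all points outside [A] contribute equally. *)
Lemma card_maps_into_add A H x : x \notin A ->
  #|maps_into (x |: A) H| * (#|T| - #|A|) = #|maps_into A H| * (#|H| - #|A|).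
Proof.
move=> xA.
transitivity (\sum_(s in maps_into A H) \sum_(y | (y \notin A) && (s y \in H)) 1); last first.
  rewrite -sum_nat_const; apply: eq_bigr => s /maps_intoP sA; rewrite sum1dep_card.
  have -> : [set y | (y \notin A) && (s y \in H)] = s @^-1: H :\: A.
    by apply/setP => y; rewrite !inE.
  have AH : A \subset s @^-1: H by apply/subsetP => y /sA; rewrite inE.
  by rewrite cardsD (setIidPr AH) card_preimset //; apply: perm_inj.
rewrite (exchange_big_dep (fun y => y \notin A)) /=; last by move=> s y _ /andP[].
have -> : #|T| - #|A| = #|~: A| by rewrite -(cardsC A) addKn.
rewrite mulnC -sum_nat_const; apply: eq_big => [y|y]; first by rewrite inE.
rewrite inE => yA; rewrite yA sum1dep_card.
rewrite -(card_imset _ (can_inj (mulKg (tperm x y)))); apply: eq_card => s.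
have tA z : z \in A -> tperm x y z = z.
  by move=> zA; rewrite tpermD //; [apply: contraNneq xA | apply: contraNneq yA] => ->.
apply/maps_intoP/imsetP => [sP|[s' + -> z]].
  exists (tperm x y * s)%g; last by rewrite mulgA tperm2 mul1g.
  apply/setIdP; split; last by rewrite permM tpermR sP ?setU11.
  apply/maps_intoP => z zA.
  by rewrite permM tA // sP // setU1r.
case/setIdP=> /maps_intoP s'P s'y; rewrite in_setU1 permM => /predU1P[->|zA].
  by rewrite tpermL.
by rewrite tA // s'P.
Qed.

(** Sampling without replacement: once [j] points are known to land in [H], the next one does so
    with probability [(#|H| - j) / (#|T| - j)], at most [#|H| / #|T|]. *)
Lemma card_maps_into A H :
  #|maps_into A H| * #|T| ^ #|A| <= #|H| ^ #|A| * #|T|`!.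
Proof.
have [k] := ubnP #|A|; elim: k A => // k IH A; rewrite ltnS => Ak.
have [->|[x xA]] := set_0Vmem A.
  by rewrite cards0 !expn0 muln1 mul1n -card_all_perm max_card.
rewrite -(setD1K xA); set B := A :\ x; have xB : x \notin B by rewrite !inE eqxx.
have cA : #|A| = #|B|.+1 by rewrite (cardsD1 x) xA.
have {}IH := IH B _; rewrite -cA in IH; have {}IH := IH Ak.
rewrite setD1K // cA -(setD1K xA) -/B.
have BT : #|B| < #|T| by rewrite -cA max_card.
have HT : #|H| <= #|T| := max_card _.
have e := card_maps_into_add H xB.
have le : #|maps_into (x |: B) H| * #|T| <= #|maps_into B H| * #|H|.
  rewrite -(leq_pmul2r (m := #|T| - #|B|)) ?subn_gt0 // mulnAC e -!mulnA leq_mul2l.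
  apply/orP; right; rewrite mulnBl mulnBr; apply: leq_sub2l.
  by rewrite [leqLHS]mulnC leq_mul2l HT orbT.
rewrite expnS mulnA; apply: leq_trans (leq_mul le (leqnn _)) _.
by rewrite mulnAC mulnC expnS -mulnA leq_mul2l IH orbT.
Qed.

Lemma card_perm_inv (P : pred {perm T}) :
  #|[set s | P s]| = #|[set s | P (s^-1)%g]|.
Proof.
rewrite -[RHS](card_imset _ (@invg_inj _)); apply: eq_card => s; rewrite [LHS]inE.
apply/idP/imsetP => [Ps|[s' + ->]]; last by rewrite inE.
by exists s^-1%g; rewrite ?inE ?invgK.
Qed.

End Perm.

(** * Union bounds, estimates of powers and binomials, and the number of edges *)

Lemma card_exists_le (I T : finType) (D : pred I) (Q : I -> pred T) :
  #|[set x | [exists (i | D i), Q i x]]| <= \sum_(i | D i) #|[set x | Q i x]|.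
Proof.
have cardE (P : pred T) : #|[set x | P x]| = \sum_x (P x : nat).
  by rewrite -sum1_card big_mkcond; apply: eq_bigr => x _; rewrite inE; case: (P x).
rewrite cardE (eq_bigr _ (fun i _ => cardE (Q i))) exchange_big; apply: leq_sum => x _.
by case: exists_inP => // -[i Di Qi]; rewrite (bigD1 i) //= Qi.
Qed.

Lemma card_existsT_le (I T : finType) (Q : I -> pred T) :
  #|[set x | [exists i, Q i x]]| <= \sum_i #|[set x | Q i x]|.
Proof.
apply: leq_trans (card_exists_le xpredT Q); apply: subset_leq_card.
by apply/subsetP => x; rewrite !inE => /existsP[i Qi]; apply/existsP; exists i.
Qed.

Lemma expn_homo e : {homo expn^~ e : a b / a <= b}.
Proof. by move=> a b ab; elim: e => // e IH; rewrite !expnS leq_mul. Qed.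

Lemma bernoulli u f q : u ^ q.+1 + q.+1 * f * u ^ q <= (u + f) ^ q.+1.
Proof.
elim: q => [|q IH]; first by rewrite !expn1 expn0 mul1n muln1.
rewrite [in X in _ <= X]expnS; apply: leq_trans (leq_mul (leqnn _) IH).
rewrite mulnDl !mulnDr -!expnS [u * _]mulnCA -expnS.
by rewrite -addnA leq_add2l [f * u ^ _]mulnC mulnC; nia.
Qed.

(** An integer form of [(1 - f / N) ^ k <= 2 ^ (- M)]. By Bernoulli's inequality, every block of
    [q], the ceiling of [N / f], factors halves the product, and [q * f <= 2 * N] leaves room for
    [M] blocks. *)
Lemma pow_decay N f k M : 0 < f <= N -> 2 * N * M <= k * f ->
  (N - f) ^ k * 2 ^ M <= N ^ k.
Proof.
move=> /andP[f0 fN] kf; pose q := (N.-1 %/ f).+1.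
have qf : N <= q * f by rewrite /q; have := divn_eq N.-1 f; have := ltn_pmod N.-1 f0; nia.
have q2 : q * f <= 2 * N by rewrite /q; have := leq_trunc_div N.-1 f; nia.
have dbl : (N - f) ^ q * 2 <= N ^ q.
  have := bernoulli (N - f) f (N.-1 %/ f); rewrite -/q subnK // => /(leq_trans _); apply.
  rewrite muln2 -addnn leq_add2l expnS leq_mul2r; apply/orP; right.
  exact: leq_trans (leq_subr _ _) qf.
have qM : q * M <= k by rewrite -(leq_pmul2r f0) mulnAC (leq_trans _ kf) // leq_mul2r q2 orbT.
move: {qf q2} q dbl qM => q dbl qM; rewrite -(subnKC qM) !expnD mulnAC leq_mul //.
  by rewrite !expnM -expnMn; apply: expn_homo.
by apply: expn_homo; apply: leq_subr.
Qed.

(* Both sides are compared with [(2 t) (2 t - 1) ... (t + 1) = 'C(2 t, t) * t!]. *)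
Lemma pow_fact t : t ^ t <= 4 ^ t * t`!.
Proof.
have -> : 4 = 2 ^ 2 by []; rewrite -expnM mul2n.
have le : 'C(t.*2, t) <= 2 ^ t.*2.
  rewrite -[X in 'C(X, _)]card_ord -card_draws -[X in _ <= _ ^ X]card_ord -cardsT.
  rewrite -card_powerset subset_leq_card //; apply/subsetP => A _.
  by rewrite powersetE subsetT.
apply: leq_trans (leq_mul le (leqnn _)); rewrite bin_ffact -addnn.
suff gen s : s <= t -> t ^ s <= (t + t) ^_ s by exact: gen.
elim: s => [|s IH] st; first by rewrite ffactn0.
by rewrite expnSr ffactnSr leq_mul ?IH //; lia.
Qed.

Lemma binomial_pow M t : 'C(M, t) * t`! <= M ^ t.
Proof.
rewrite bin_ffact; elim: t => [|t IH]; first by rewrite ffactn0.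
by rewrite expnSr ffactnSr leq_mul // leq_subr.
Qed.

Lemma card_edge n : #|{: edge n}| = 'C(n, 2).
Proof.
rewrite card_sig -sum1_card.
transitivity (\sum_(i : 'I_n) \sum_(j : 'I_n | i < j) 1); first by rewrite pair_big_dep.
rewrite (exchange_big_dep predT) //= -bin2_sum big_mkord; apply: eq_bigr => j _.
have w_inj : injective (widen_ord (ltnW (ltn_ord j))).
  by move=> a b /(congr1 val) /= /val_inj.
rewrite sum1dep_card -[RHS]card_ord -(card_imset _ w_inj).
apply: eq_card => i; rewrite inE; apply/idP/imsetP => [ij|[i' _ ->]].
  by exists (Ordinal ij) => //; apply: val_inj.
exact: ltn_ord i'.
Qed.

(** * Probabilities of the two bad events *)

Section RandomStream.
Variable n : nat.
Hypothesis n1 : 1 < n.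
Implicit Types (A B : {set 'I_n}) (X : {set edge n}) (s : {perm edge n}) (k a : nat).
Let N := 'C(n, 2).
Let L := log_size n.

(** Stream positions are named by edges: [s e] arrives at the position of [e] in the enumeration. *)
Definition first k : {set edge n} := [set e in take k (enum {: edge n})].
Definition stream s : seq (edge n) := [seq s e | e <- enum {: edge n}].
Definition crossing A B : {set edge n} := [set e | crosses A B e].
Definition touching B : {set edge n} := [set e | touches B e].

Lemma size_enum_edge : size (enum {: edge n}) = N.
Proof. by rewrite -cardE card_edge. Qed.

Lemma card_first k : k <= N -> #|first k| = k.
Proof.
move=> kN; rewrite cardsE (card_uniqP _) ?take_uniq ?enum_uniq //.
by rewrite size_takel ?size_enum_edge.
Qed.

Lemma n_lt_pow : n < 2 ^ L.
Proof. exact: trunc_log_ltn. Qed.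

Lemma N_lt_sqr : N.+1 <= n ^ 2.
Proof.
have := odd_double_half (n * n.-1); rewrite /N bin2 -mul2n expnS expn1; nia.
Qed.

Lemma N_gt0 : 0 < N.
Proof. by rewrite /N bin_gt0. Qed.

(** Orienting each crossing edge to start in [A] covers all of [A * B]. *)
Lemma card_crossing A B : [disjoint A & B] -> #|A| * #|B| <= #|crossing A B|.
Proof.
move=> AB; rewrite -cardsX.
pose g (e : edge n) := if (val e).1 \in A then val e else ((val e).2, (val e).1).
apply: leq_trans (leq_imset_card g (crossing A B)); apply: subset_leq_card.
apply/subsetP => -[x y]; rewrite inE /= => /andP[xA yB].
have yA : y \notin A by move/pred0P: AB => /(_ y) /=; rewrite yB andbT => ->.
have xy : x != y by apply: contraNneq yA => <-.
apply/imsetP; have [lt|lt|e] := ltngtP x y.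
- by exists (Sub (x, y) lt : edge n); rewrite ?inE /crosses /g SubK /= xA ?yB.
- by exists (Sub (y, x) lt : edge n); rewrite ?inE /crosses /g SubK /= ?(negbTE yA) ?xA ?yB ?orbT.
- by rewrite (val_inj e) eqxx in xy.
Qed.

Lemma card_touching B : #|touching B| <= #|B| * n.
Proof.
pose g (e : edge n) := if (val e).1 \in B then val e else ((val e).2, (val e).1).
have g_inj : injective g.
  move=> [[x y] /= xy] [[x' y'] /= xy']; rewrite /g /=.
  by do 2!case: ifP => _; case=> ex ey; apply: val_inj; rewrite /= ?ex ?ey //;
    move: xy xy'; rewrite ?ex ?ey => xy; rewrite ltnNge (ltnW xy).
rewrite -(card_imset _ g_inj) -[n in _ * n]card_ord -cardsT -cardsX subset_leq_card //.
apply/subsetP => _ /imsetP[e + ->]; rewrite !inE /g /touches andbT.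
by case: ifP.
Qed.

(** At least [a * a] edges cross, so missing them all has probability at most [(1 - a * a / N) ^ k];
    the hypothesis on [spread] gives [16 * N * L < a * k], as [pow_decay] requires. *)
Lemma card_not_crossed k A B a :
  0 < a -> #|A| = a -> #|B| = a -> [disjoint A & B] -> k <= N -> spread n < 16 * a * k ->
  #|maps_into (first k) (~: crossing A B)| * 2 ^ (8 * a * L) <= N`!.
Proof.
move=> a0 Aa Ba AB kN ak; have := card_maps_into (first k) (~: crossing A B).
have := card_crossing AB; rewrite Aa Ba; set f := #|crossing A B| => af.
have -> : #|~: crossing A B| = N - f by rewrite cardsCs setCK card_edge.
rewrite card_first // card_edge -/N => le.
have fN : f <= N by rewrite /N -card_edge max_card.
have M : 2 * N * (8 * a * L) <= k * f.
  have : 16 * N * L < a * k by move: ak; rewrite /spread -/N -/L; lia.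
  by move=> lt; apply: (@leq_trans (k * (a * a))); [nia | rewrite leq_mul2l af orbT].
have f0 : 0 < f <= N by rewrite fN andbT; apply: leq_trans af; rewrite muln_gt0 a0.
have := pow_decay f0 M => dec.
rewrite -(leq_pmul2r (m := N ^ k)) ?expn_gt0 ?N_gt0 // mulnAC.
apply: leq_trans (leq_mul le (leqnn _)) _; rewrite mulnAC [leqRHS]mulnC leq_mul2r.
by rewrite dec orbT.
Qed.

Definition not_expanding : {set {perm edge n}} := [set s |
  [exists k : 'I_N.+1, exists (a : 'I_n.+1 | (0 < a) && (spread n < 16 * a * k)),
   exists (A : {set 'I_n} | #|A| == a), exists (B : {set 'I_n} | (#|B| == a) && [disjoint A & B]),
     s \in maps_into (first k) (~: crossing A B)]].

(** For each [a], at most [2 ^ (2 * a * L)] pairs of sets fail with probability [2 ^- (8 * a * L)]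
    each, leaving at most [2 ^- (6 * L)]. This outweighs the choices of [k] and [a] and the factor
    [n], whose product is at most [n ^ 6]. *)
Lemma card_not_expanding : n * #|not_expanding| <= N`!.
Proof.
pose c := N`! %/ 2 ^ (6 * L).
have cE : 2 ^ (6 * L) * c <= N`! by rewrite mulnC leq_trunc_div.
suff le : #|not_expanding| <= N.+1 * (n.+1 * c).
  apply: leq_trans cE; apply: leq_trans (leq_mul (leqnn n) le) _.
  have : n ^ 6 <= 2 ^ (6 * L) by rewrite mulnC expnM; apply: expn_homo; exact: ltnW n_lt_pow.
  have := N_lt_sqr => N2 n6; rewrite !mulnA leq_mul2r; apply/orP; right.
  apply: leq_trans n6; have -> : n ^ 6 = n * n ^ 2 * (n * n ^ 2) by rewrite -!expnS -expnD.
  by rewrite leq_mul ?leq_mul //; nia.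
apply: leq_trans (card_existsT_le _) _.
rewrite -[X in X * _]card_ord -sum_nat_const; apply: leq_sum => k _.
apply: leq_trans (card_exists_le _ _) _.
rewrite -[X in X * _]card_ord -sum_nat_const big_mkcond; apply: leq_sum => a _.
case: ifP => // /andP[a0 ak].
have kN : k <= N by rewrite -ltnS.
apply: leq_trans (card_exists_le _ _) _.
have bound A B : #|A| == a -> (#|B| == a) && [disjoint A & B] ->
    #|maps_into (first k) (~: crossing A B)| <= N`! %/ 2 ^ (8 * a * L).
  move=> /eqP Aa /andP[/eqP Ba AB]; rewrite leq_divRL ?expn_gt0 //.
  exact: card_not_crossed.
have Ca : 'C(n, a) <= 2 ^ (a * L).
  have := binomial_pow n a; have := fact_gt0 a => f0 le.
  apply: leq_trans (leq_trans (leq_pmulr _ f0) le) _.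
  by rewrite mulnC expnM; apply: expn_homo; exact: ltnW n_lt_pow.
set d := N`! %/ 2 ^ (8 * a * L) in bound.
apply: (@leq_trans (2 ^ (a * L) * (2 ^ (a * L) * d))).
  apply: (@leq_trans (\sum_(A : {set 'I_n} | #|A| == a) 2 ^ (a * L) * d)); last first.
    by rewrite sum_nat_cond_const card_draws card_ord leq_mul2r Ca orbT.
  apply: leq_sum => A Aa; apply: leq_trans (card_exists_le _ _) _.
  apply: (@leq_trans (\sum_(B : {set 'I_n} | #|B| == a) d)); last first.
    by rewrite sum_nat_cond_const card_draws card_ord leq_mul2r Ca orbT.
  rewrite big_mkcond [leqRHS]big_mkcond; apply: leq_sum => B _.
  case: ifP => // BP; have := bound A B Aa BP; case/andP: (BP) => -> _.
  by congr (_ <= _); apply: eq_card => s; rewrite inE.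
rewrite /c leq_divRL ?expn_gt0 //.
apply: (@leq_trans (d * 2 ^ (8 * a * L))); last exact: leq_trunc_div.
rewrite mulnA -expnD mulnAC -expnD mulnC leq_mul2l; apply/orP; right.
by rewrite leq_exp2l //; nia.
Qed.

(** Too many early edges at [B] means that some [capacity n] of them all have early positions, and
    positions are given by the inverse of [s]. *)
Definition not_sparse : {set {perm edge n}} := [set s |
  [exists k : 'I_N.+1, exists (B : {set 'I_n} | #|B| * k <= spread n),
   exists (X : {set edge n} | (X \subset touching B) && (#|X| == capacity n)),
     s^-1%g \in maps_into X (first k)]].

(** For fixed [B] and [k], with [D] edges touching [B], the union bound over [X] gives
    ['C(D, t) * (k / N) ^ t]. By [pow_fact] this is at most [(4 * D * k / (N * t)) ^ t], hence at
    most [2 ^- t]; and [t] absorbs the [2 ^ n] sets as well as the polynomial factors. *)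
Lemma card_not_sparse : n * #|not_sparse| <= N`!.
Proof.
set t := capacity n.
pose c := N`! %/ 2 ^ t.
have cE : 2 ^ t * c <= N`! by rewrite mulnC leq_trunc_div.
suff le : #|not_sparse| <= N.+1 * (2 ^ n * c).
  apply: leq_trans cE; apply: leq_trans (leq_mul (leqnn n) le) _.
  rewrite !mulnA leq_mul2r; apply/orP; right.
  have n3 : n ^ 3 <= 2 ^ (3 * L) by rewrite mulnC expnM; apply: expn_homo; exact: ltnW n_lt_pow.
  apply: (@leq_trans (2 ^ (3 * L) * 2 ^ n)).
    rewrite leq_mul2r; apply/orP; right; apply: leq_trans n3.
    by rewrite expnS leq_mul2l N_lt_sqr orbT.
  by rewrite -expnD leq_exp2l // /t /capacity -/L; have : 0 < L by []; nia.
apply: leq_trans (card_existsT_le _) _.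
rewrite -[X in X * _]card_ord -sum_nat_const; apply: leq_sum => k _.
apply: leq_trans (card_exists_le _ _) _.
have -> : 2 ^ n = #|{set 'I_n}|.
  by rewrite -[RHS]cardsT -powersetT card_powerset cardsT card_ord.
rewrite -sum_nat_const big_mkcond; apply: leq_sum => B _.
case: ifP => // Bk; have kN : k <= N by rewrite -ltnS.
set x := #|_|.
have xle : x * N ^ t <= 'C(#|touching B|, t) * (k ^ t * N`!).
  rewrite /x; apply: leq_trans (leq_mul (card_exists_le _ _) (leqnn _)) _.
  rewrite -cards_draws -sum_nat_cond_const big_distrl /=.
  apply: leq_sum => X /andP[_ /eqP Xt].
  have := card_maps_into X (first k); rewrite card_first // card_edge Xt.
  congr (_ * _ <= _); rewrite -(card_perm_inv (mem (maps_into X (first k)))).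
  by apply: eq_card => s; rewrite [RHS]inE.
have Nt : 8 * (#|touching B| * k) <= N * t.
  apply: (@leq_trans (8 * n * (#|B| * k))).
    by have := leq_mul (card_touching B) (leqnn k); lia.
  (* The constant 2048 in [capacity] is [8 * 256], making [8 * n * spread n] equal to [N * t]. *)
  apply: (@leq_trans (8 * n * spread n)); first by rewrite leq_mul2l Bk orbT.
  rewrite /spread /t /capacity -/N -/L; move: (N) (L) => a b; lia.
have t0 : 0 < t by rewrite /t /capacity !muln_gt0 (ltnW n1).
rewrite /c leq_divRL ?expn_gt0 //.
have Nt0 : 0 < (N * t) ^ t by rewrite expn_gt0 muln_gt0 N_gt0 t0.
rewrite -(leq_pmul2r Nt0).
have step1 : x * (N * t) ^ t <= (4 * (#|touching B| * k)) ^ t * N`!.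
  rewrite expnMn mulnA; apply: leq_trans (leq_mul xle (pow_fact t)) _.
  rewrite !expnMn [X in _ <= X]mulnAC.
  have := binomial_pow #|touching B| t => bp.
  have -> : 'C(#|touching B|, t) * (k ^ t * N`!) * (4 ^ t * t`!) =
    4 ^ t * (('C(#|touching B|, t) * t`!) * k ^ t) * N`! by nia.
  by rewrite mulnAC leq_mul // leq_mul // leq_mul.
rewrite mulnAC; apply: leq_trans (leq_mul step1 (leqnn _)) _.
rewrite mulnAC [leqRHS]mulnC leq_mul2r -expnMn; apply/orP; right.
by apply: expn_homo; move: Nt; lia.
Qed.

Lemma stream_good s k m : s \notin not_expanding -> s \notin not_sparse -> k <= m -> m <= N ->
  expanding k (gnm_stream m s) /\ sparse k (gnm_stream m s).
Proof.
move=> ne ns km mN; have kN := leq_trans km mN.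
have kN' : k < N.+1 by [].
have takeE : take k (gnm_stream m s) = [seq s e | e <- take k (enum {: edge n})].
  by rewrite /gnm_stream -take_min (minn_idPl km) map_take.
split=> [a A B a0 ak Aa Ba AB|B Bk]; rewrite takeE.
  apply: contraR ne => /hasPn no.
  have an : a < n.+1 by rewrite ltnS -Aa -[leqRHS]card_ord max_card.
  rewrite inE; apply/existsP; exists (Ordinal kN').
  apply/exists_inP; exists (Ordinal an); first by rewrite a0.
  apply/exists_inP; exists A; first by rewrite /= Aa.
  apply/exists_inP; exists B; first by rewrite /= Ba eqxx.
  by apply/maps_intoP => e; rewrite !inE => ek; apply: no; apply: map_f.
rewrite leqNgt; apply: contra ns => lt.
pose Z := [seq e <- [seq s e | e <- take k (enum {: edge n})] | touches B e].
have uZ : uniq Z.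
  by rewrite filter_uniq // map_inj_uniq ?take_uniq ?enum_uniq //; apply: perm_inj.
rewrite inE; apply/existsP; exists (Ordinal kN').
apply/exists_inP; exists B => //.
(* The union bound ranges over sets of exactly [capacity n] edges, so the excess is cut off. *)
apply/exists_inP; exists [set e in take (capacity n) Z].
  apply/andP; split.
    by apply/subsetP => e; rewrite !inE => /mem_take; rewrite mem_filter => /andP[].
  rewrite cardsE (card_uniqP _) ?take_uniq // size_takel // size_filter ltnW //.
apply/maps_intoP => e; rewrite !inE => /mem_take; rewrite mem_filter => /andP[_ /mapP[e' e'k ->]].
by rewrite permK.
Qed.

Lemma size_gnm_stream s m : size (gnm_stream m s) <= 'C(n, 2).
Proof.
by rewrite size_take_min size_map size_enum_edge geq_minr.
Qed.

End RandomStream.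

(** * Arbitrary streams, word and space bounds, and the conclusion *)

(** With arrays long enough for the whole stream, correctness does not depend on how much gets
    frozen. *)
Lemma maintains_dfs_any n (es : seq (edge n)) W :
  n + size es + 13 < W ->
  maintains_dfs (n + (5 * (n + size es + 13) + 3)) W stick_dfs es.
Proof.
move=> KW.
apply: (@run_invariant n (n + size es + 13) W _ _ KW es (fun _ _ => True)) => //; try lia.
move=> k fz kes _ _ _; split=> //.
apply: leq_ltn_trans (size_kept fz (take k es)) _.
rewrite -addnA ltn_add2l; apply: leq_ltn_trans (count_size _ _) _.
by rewrite size_takel ?(ltnW kes) // ltn_addr.
Qed.

Lemma log_size_le n : log_size n <= n.+1.
Proof.
case: n => [|n] //; have := trunc_logP (isT : 1 < 2) (ltn0Sn n).
by rewrite /log_size ltnS => /(leq_trans (ltn_expl _ _)) => /(_ isT) /ltnW.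
Qed.

(** The constant [2 ^ 12] is absorbed by twelve further factors [n.+2]. *)
Lemma poly_word_bound x n : x <= 2 ^ 12 * n.+2 ^ 2 -> x <= word_bound 14 n.
Proof.
move/leq_trans; apply; rewrite /word_bound (expnD n.+2 12 2) leq_mul2r.
by apply/orP; right; apply: expn_homo.
Qed.

Lemma capacity_word n : n + capacity n + 13 < word_bound 14 n.
Proof.
apply: poly_word_bound; have := log_size_le n; rewrite /capacity; move: (log_size n) => l le.
have : n * l <= n * n.+1 by rewrite leq_mul2l le orbT.
by rewrite -[2 ^ 12]/4096 -mulnn; lia.
Qed.

(** With [l] the truncated logarithm, [log_size n = l + 1 <= 2 * l] and the additive constant [68]
    is at most [34 * n]; the coefficients add up to [20480 + 6 + 34 = 5 * 4104]. *)
Lemma capacity_space n : 1 < n ->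
  n + (5 * (n + capacity n + 13) + 3) <= 5 * 4104 * (n * trunc_log 2 n).
Proof.
move=> n1; have : 0 < trunc_log 2 n by rewrite trunc_log_gt0 /=; lia.
rewrite /capacity /log_size; move: (trunc_log 2 n) => l l0.
have : n <= n * l by rewrite leq_pmulr.
lia.
Qed.

Lemma stream_word n (es : seq (edge n)) : uniq es -> n + size es + 13 < word_bound 14 n.
Proof.
move=> /card_uniqP es_uniq; apply: poly_word_bound.
have : size es <= n ^ 2.
  rewrite -es_uniq (leq_trans (max_card _)) // card_edge.
  exact: leq_trans (leq_pmulr _ (fact_gt0 2)) (binomial_pow n 2).
by rewrite -[2 ^ 12]/4096 -!mulnn; lia.
Qed.

Theorem theorem7p2 :
  exists (A : stream_alg) (c C D : nat),
    (forall (n : nat) (es : seq (edge n)), uniq es ->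
       exists S : nat, maintains_dfs S (word_bound c n) A es) /\
    (forall n m : nat, 1 < n -> m <= 'C(n, 2) ->
       (1 - D%:R / n%:R <=
        uniform_prob (fun s : {perm edge n} =>
          maintains_dfs (C * (n * trunc_log 2 n)) (word_bound c n) A
                        (gnm_stream m s)))%R).
Proof.
(* The last witness counts the two bad events, each of probability at most [1 / n]. *)
exists stick_dfs, 14, (5 * 4104), 2; split=> [n es /stream_word esW|n m n1 mN].
  by exists (n + (5 * (n + size es + 13) + 3)); apply: maintains_dfs_any.
rewrite /uniform_prob card_all_perm card_edge; set good := [set s | _].
pose bad := not_expanding n :|: not_sparse n.
have bad_le : n * #|bad| <= 2 * 'C(n, 2)`!.
  rewrite mul2n -addnn; apply: leq_trans (leq_add (card_not_expanding n1) (card_not_sparse n1)).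
  by rewrite -mulnDr leq_mul2l cardsU leq_subr orbT.
have good_ge : 'C(n, 2)`! <= #|good| + #|bad|.
  rewrite -card_edge -card_all_perm -(cardsC bad) addnC leq_add2r subset_leq_card //.
  apply/subsetP => s; rewrite in_setC in_setU negb_or => /andP[ne ns]; rewrite inE; apply/asboolP.
  apply: maintains_dfs_mono (capacity_space n1) _.
  apply: good_maintains; rewrite ?capacity_word ?size_gnm_stream // => k kes.
  apply: stream_good => //; apply: leq_trans kes _.
  by rewrite size_take_min geq_minl.
have n0 : (0 < n%:R :> rat)%R by rewrite Num.Theory.ltr0n ltnW.
rewrite Num.Theory.ler_pdivlMr ?Num.Theory.ltr0n ?fact_gt0 //.
rewrite GRing.mulrBl GRing.mul1r Num.Theory.lerBlDr.
have bad_rat : (#|bad|%:R <= 2%:R / n%:R * ('C(n, 2)`!)%:R :> rat)%R.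
  by rewrite GRing.mulrAC Num.Theory.ler_pdivlMr // -!GRing.natrM Num.Theory.ler_nat mulnC.
apply: Order.POrderTheory.le_trans (Num.Theory.lerD (Order.POrderTheory.lexx _) bad_rat).
by rewrite -GRing.natrD Num.Theory.ler_nat.
Qed.
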